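(* Let $\alpha>0$ and let $\mu$ be a positive Borel measure on $(0,\infty)$. Then each of the following statements implies the one that follows it: (i) $\sum_{n=0}^\infty \mu_n<\infty$. (ii) $\mathcal{H}_\mu:f^\infty_\alpha\to f^\infty_\alpha$ is nuclear. (iii) $\mathcal{H}_\mu:f^\infty_\alpha\to f^\infty_\alpha$ is absolutely summing. (iv) $\sum_{n=0}^\infty \mu_n (n+1)^{-1/2}<\infty$.
   Context: For $\alpha>0$, $f^\infty_\alpha$ is the Banach space of entire functions $f$ with $\lim_{|z|\to\infty}|f(z)|e^{-\frac{\alpha}{2}|z|^2}=0$, with norm $\|f\|_{\infty,\alpha}=\sup_{z\in\mathbb C}|f(z)|e^{-\frac{\alpha}{2}|z|^2}$. The Hausdorff operator is $\mathcal{H}_\mu(f)(z)=\int_0^\infty f\left(\frac{z}{t}\right)\frac{d\mu(t)}{t}$ for entire $f$, and $\mu_n=\int_0^\infty\frac{d\mu(t)}{t^{n+1}}$ for $n=0,1,2,\dots$. An operator $T:X\to Y$ between Banach spaces is nuclear if $T=\sum_{n=0}^\infty x_n^*\otimes y_n$, where $x^*\otimes y$ is the operator $x\mapsto\langle x^*,x\rangle y$, with $\sum_n\|x_n^*\|_{X^*}<\infty$ and $(y_n)\subset Y$ bounded. A bounded operator $T:X\to Y$ is absolutely summing (i.e. $1$-summing) if $\sum_n\|T(x_n)\|_Y<\infty$ for every sequence $(x_n)\subset X$ such that $\sum_n|\langle x^*,x_n\rangle|<\infty$ for all $x^*\in X^*$. Statements (ii) and (iii) include that $\mathcal{H}_\mu$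 is well defined and bounded on $f^\infty_\alpha$. *)

(* Defs.v *)
Set Warnings "-notation-overridden,-ambiguous-paths".
From HB Require Import structures.
From mathcomp Require Import all_boot all_order all_algebra.
From mathcomp Require Import all_classical all_reals all_analysis.
From mathcomp Require Import complex.

Set Implicit Arguments.
Unset Strict Implicit.
Unset Printing Implicit Defensive.

Import Order.TTheory GRing.Theory Num.Theory.
Import numFieldNormedType.Exports.

Local Open Scope classical_set_scope.
Local Open Scope complex_scope.
Local Open Scope ring_scope.

(* The norm of a normed module over R[i] takes its values in R[i]; they are
   nonnegative reals, and rnorm reads them in R. *)
Definition rnorm (R : realType) (V : normedModType R[i]) (x : V) : R :=
  complex.Re `|x|.

Section rnorm_theory.
Context {R : realType}.
Implicit Types V : normedModType R[i].

Lemma rnormE V (x : V) : `|x| = (rnorm x)%:C.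
Proof.
rewrite /rnorm; have := normr_ge0 x.
by case: `|x| => a b; rewrite lecE /= => /andP[/eqP-> _].
Qed.

Lemma rnorm_ge0 V (x : V) : 0 <= rnorm x.
Proof. by rewrite -lecR -rnormE normr_ge0. Qed.

Lemma rnormD V (x y : V) : rnorm (x + y) <= rnorm x + rnorm y.
Proof. by rewrite -lecR rmorphD /= -!rnormE ler_normD. Qed.

Lemma rnormZ V (a : R[i]) (x : V) : rnorm (a *: x) = rnorm (a : R[i]^o) * rnorm x.
Proof.
have : (rnorm (a *: x))%:C = (rnorm (a : R[i]^o) * rnorm x)%:C.
  by rewrite rmorphM /= -!rnormE normrZ.
by case.
Qed.

Lemma rnorm0 V : rnorm (0 : V) = 0.
Proof. by rewrite /rnorm normr0. Qed.

Lemma rnorm0_eq0 V (x : V) : rnorm x = 0 -> x = 0.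
Proof. by move=> x0; apply/eqP; rewrite -normr_eq0 rnormE x0. Qed.

End rnorm_theory.

Section complex_functions.
Context {R : realType}.
Local Notation C := (R[i]^o).
Implicit Types f g : C -> C.

Definition entire f := forall z : C, derivable f z 1.

Definition cinfty_nbhs : set_system C :=
  filter_from [set: R] (fun M => [set z : C | M < rnorm z]).

Global Instance cinfty_nbhs_filter : ProperFilter cinfty_nbhs.
Proof.
apply: filter_from_proper; last first.
  move=> M _; exists ((`|M| + 1)%:C : C) => /=.
  have M1 : 0 <= `|M| + 1 by [rewrite addr_ge0].
  rewrite /rnorm ger0_norm ?lecR//=.
  by rewrite (le_lt_trans (ler_norm M))// ltrDl.
apply: filter_from_filter; first by exists 0.
move=> M N _ _; exists (Num.max M N) => // z /=.
by rewrite gt_max => /andP[].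
Qed.

Definition gauss (alpha : R) (z : C) : R := expR (- (alpha / 2) * rnorm z ^+ 2).

Definition fock_weight (alpha : R) f (z : C) : R := rnorm (f z) * gauss alpha z.

Definition is_fock_infty (alpha : R) f : Prop :=
  entire f /\ fock_weight alpha f z @[z --> cinfty_nbhs] --> 0.

Lemma entire_continuous f : entire f -> continuous f.
Proof.
by move=> ef z; apply/differentiable_continuous/derivable1_diffP; exact: ef.
Qed.

Lemma rnorm_continuous : continuous (fun z : C => rnorm z : R).
Proof.
move=> z; apply/(@cvgrPdist_lt _ R^o _ (nbhs z)) => e e0.
have e0C : 0 < e%:C by rewrite ltcR.
have : nbhs z (ball z e%:C) by exact: nbhsx_ballx.
apply: filterS => w; rewrite -ball_normE /=.
rewrite rnormE ltcR; apply: le_lt_trans.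
have H : forall a b : C, rnorm a - rnorm b <= rnorm (a - b).
  by move=> a b; rewrite lerBlDr -{1}(subrK b a) rnormD.
rewrite ler_norml H lerNl opprB (le_trans (H w z))//.
by rewrite -lecR -!rnormE distrC.
Qed.

Lemma entire_bounded_disc f (M : R) : entire f ->
  exists B : R, forall z : C, rnorm z <= M -> rnorm (f z) <= B.
Proof.
move=> ef.
pose h (p : R * R) : C := p.1 +i* p.2.
have hc : continuous h.
  move=> p; apply/cvgrPdist_lt => e e0.
  have [e1 ee1] : exists r : R, e = r%:C.
    by exists (complex.Re e); move: e0; case: (e) => a b /=; rewrite ltcE /= => /andP[/eqP-> _].
  move: e0; rewrite ee1 ltcR => e0.
  have e2 : 0 < e1 / 2 by rewrite divr_gt0.
  have H1 : \forall q \near p, `|p.1 - q.1| < e1 / 2.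
    by apply: (@cvgr_dist_lt _ _ _ (nbhs p) _ fst) => //; exact: cvg_fst.
  have H2 : \forall q \near p, `|p.2 - q.2| < e1 / 2.
    by apply: (@cvgr_dist_lt _ _ _ (nbhs p) _ snd) => //; exact: cvg_snd.
  near=> q.
  have q1 : `|p.1 - q.1| < e1 / 2 by near: q.
  have q2 : `|p.2 - q.2| < e1 / 2 by near: q.
  have -> : h p - h q = (p.1 - q.1)%:C + (0 +i* (p.2 - q.2)).
    by rewrite /h; simpc.
  apply: (le_lt_trans (ler_normD _ _)).
  rewrite !normc_def /= expr0n /= addr0 add0r !sqrtr_sqr.
  by rewrite -rmorphD ltcR (splitr e1) ltrD.
have cK : compact (`[- M, M] `*` `[- M, M] : set (R * R)).
  by apply: compact_setX; exact: segment_compact.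
have : compact ((fun p => rnorm (f (h p))) @` (`[- M, M] `*` `[- M, M])).
  apply: continuous_compact => //; apply: continuous_subspaceT => p.
  apply: (@continuous_comp _ _ _ h (fun z => rnorm (f z))); first exact: hc.
  apply: (@continuous_comp _ _ _ f (fun z : C => rnorm z)).
    exact: entire_continuous.
  exact: rnorm_continuous.
move=> /compact_bounded/pinfty_ex_gt0[B _ HB]; exists B => z zM.
have [a [b zab]] : exists a b, z = a +i* b by case: (z) => a b; exists a, b.
have zE : rnorm z = Num.sqrt (a ^+ 2 + b ^+ 2) by rewrite zab /rnorm normc_def.
have aM : `|a| <= M.
  rewrite (le_trans _ zM)// zE -sqrtr_sqr ler_sqrt ?addr_ge0 ?sqr_ge0//.
  by rewrite lerDl sqr_ge0.
have bM : `|b| <= M.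
  rewrite (le_trans _ zM)// zE -sqrtr_sqr ler_sqrt ?addr_ge0 ?sqr_ge0//.
  by rewrite lerDr sqr_ge0.
have : `|rnorm (f z)| <= B.
  by apply: HB; exists (a, b) => /=; [rewrite !in_itv /= -!ler_norml|rewrite zab].
by apply: le_trans; exact: ler_norm.
Unshelve. all: by end_near. Qed.

Lemma gauss_gt0 alpha (z : C) : 0 < gauss alpha z.
Proof. exact: expR_gt0. Qed.

Lemma fock_weight_ge0 alpha f z : 0 <= fock_weight alpha f z.
Proof. by rewrite mulr_ge0 ?rnorm_ge0// ltW// gauss_gt0. Qed.

Lemma fock_weight_bounded alpha f : is_fock_infty alpha f ->
  has_ubound (range (fock_weight alpha f)).
Proof.
move=> [ef /cvgrPdist_lt/(_ 1 ltr01)[M _ HM]].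
have [B HB] := entire_bounded_disc M ef.
exists (Num.max 1 (B * expR (`|alpha| * M ^+ 2))) => _ [z _ <-].
rewrite le_max; have [zM|Mz] := leP (rnorm z) M; last first.
  have := HM z Mz; rewrite /= sub0r normrN ger0_norm ?fock_weight_ge0//.
  by move=> /ltW ->.
apply/orP; right; rewrite ler_pM ?rnorm_ge0 ?HB//; first exact/ltW/gauss_gt0.
rewrite ler_expR (le_trans (ler_norm _))// normrM ler_pM//.
  rewrite normrN normrM ler_piMr// ger0_norm ?invr_ge0//.
  by rewrite invf_le1// ler1n.
rewrite ger0_norm ?sqr_ge0// lerXn2r// ?nnegrE ?rnorm_ge0//.
by rewrite (le_trans _ zM) ?rnorm_ge0.
Qed.

End complex_functions.

Section fock_infty_space.
Context {R : realType} (alpha : R).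
Local Notation C := (R[i]^o).

Definition fock_infty_pred : {pred C -> C} := mem [set f | is_fock_infty alpha f].

Lemma fock_infty_predP (f : C -> C) :
  reflect (is_fock_infty alpha f) (f \in fock_infty_pred).
Proof. by apply: (iffP idP); rewrite /fock_infty_pred inE. Qed.

Record fock_infty := FockInfty {
  fock_fun :> C -> C ;
  _ : fock_fun \in fock_infty_pred }.

HB.instance Definition _ := [isSub for fock_fun].
HB.instance Definition _ := [Choice of fock_infty by <:].

Lemma fock_infty_submod : submod_closed fock_infty_pred.
Proof.
split=> [|a f g /fock_infty_predP[ef cf] /fock_infty_predP[eg cg]].
  apply/fock_infty_predP; split => [z|]; first exact: derivable_cst.
  have -> : fock_weight alpha (0 : C -> C) = cst 0.
    by apply/funext => z; rewrite /fock_weight rnorm0 mul0r.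
  exact: cvg_cst.
apply/fock_infty_predP; split => [z|].
  by apply: derivableD; [apply: derivableZ; exact: ef|exact: eg].
have H : rnorm (a : C) * fock_weight alpha f z + fock_weight alpha g z
    @[z --> cinfty_nbhs] --> (0 : R).
  rewrite -[X in _ --> X](addr0 (0 : R)) -{1}(mulr0 (rnorm (a : C))).
  by apply: cvgD => //; apply: cvgM => //; exact: cvg_cst.
apply: (squeeze_cvgr _ (cvg_cst (0 : R)) H).
near=> z; rewrite fock_weight_ge0 /= /fock_weight mulrA -mulrDl.
rewrite ler_wpM2r ?(ltW (gauss_gt0 _ _))//.
by rewrite (le_trans (rnormD _ _))// rnormZ.
Unshelve. all: by end_near. Qed.

HB.instance Definition _ :=
  GRing.isSubmodClosed.Build _ _ fock_infty_pred fock_infty_submod.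
HB.instance Definition _ := [SubChoice_isSubLmodule of fock_infty by <:].

Definition fock_norm (f : fock_infty) : R := sup (range (fock_weight alpha f)).

Lemma fock_inftyP (f : fock_infty) : is_fock_infty alpha f.
Proof. exact/fock_infty_predP/valP. Qed.

Lemma fock_weight_le_norm (f : fock_infty) z : fock_weight alpha f z <= fock_norm f.
Proof.
apply: ub_le_sup; last by exists z.
exact/fock_weight_bounded/fock_inftyP.
Qed.

Lemma fock_norm_le (f : fock_infty) (M : R) :
  (forall z, fock_weight alpha f z <= M) -> fock_norm f <= M.
Proof.
move=> H; apply: ge_sup; first by exists (fock_weight alpha f 0), 0.
by move=> _ [z _ <-].
Qed.

Lemma fock_norm_ge0 (f : fock_infty) : 0 <= fock_norm f.
Proof. exact: le_trans (fock_weight_ge0 _ _ 0) (fock_weight_le_norm f 0). Qed.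

Let fock_normD (f g : fock_infty) :
  (fock_norm (f + g))%:C <= (fock_norm f)%:C + (fock_norm g)%:C.
Proof.
rewrite -rmorphD lecR; apply: fock_norm_le => z.
apply: le_trans (lerD (fock_weight_le_norm f z) (fock_weight_le_norm g z)).
by rewrite /fock_weight -mulrDl ler_wpM2r ?(ltW (gauss_gt0 _ _))// rnormD.
Qed.

Let fock_normZ_le (a : R[i]) (f : fock_infty) :
  fock_norm (a *: f) <= rnorm (a : C) * fock_norm f.
Proof.
apply: fock_norm_le => z.
apply: (@le_trans _ _ (rnorm (a : C) * fock_weight alpha f z)).
  by rewrite /fock_weight mulrA rnormZ.
by rewrite ler_wpM2l ?rnorm_ge0// fock_weight_le_norm.
Qed.

Let fock_normZ (a : R[i]) (f : fock_infty) :
  (fock_norm (a *: f))%:C = `|a| * (fock_norm f)%:C.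
Proof.
rewrite (rnormE (a : C)) -rmorphM; congr (_%:C).
have [->|a0] := eqVneq a 0.
  apply/eqP; rewrite rnorm0 mul0r eq_le fock_norm_ge0 andbT.
  by rewrite (le_trans (fock_normZ_le _ _))// rnorm0 mul0r.
have na0 : 0 < rnorm (a : C).
  rewrite lt_neqAle rnorm_ge0 andbT eq_sym.
  by apply: contra a0 => /eqP/rnorm0_eq0/eqP.
apply/eqP; rewrite eq_le fock_normZ_le/=.
rewrite -ler_pdivlMl//; have := fock_normZ_le a^-1 (a *: f).
rewrite scalerA mulVf// scale1r.
have [->//] : (rnorm (a^-1 : C))%:C = ((rnorm (a : C))^-1)%:C.
by rewrite fmorphV -!rnormE normfV.
Qed.

Let fock_norm_eq0 (f : fock_infty) : (fock_norm f)%:C = 0 :> R[i] -> f = 0.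
Proof.
move=> [f0]; apply/val_inj/funext => z; apply: rnorm0_eq0.
have := fock_weight_le_norm f z; rewrite f0 /fock_weight.
rewrite pmulr_lle0 ?gauss_gt0// => H.
by apply/eqP; rewrite eq_le H rnorm_ge0.
Qed.

HB.instance Definition _ := Lmodule_isNormed.Build R[i] fock_infty
  fock_normD fock_normZ fock_norm_eq0.

End fock_infty_space.

Section operator_classes.
Context {R : realType}.
Local Notation C := (R[i]^o).
Local Open Scope ereal_scope.

Definition opnorm (X Y : normedModType R[i]) (T : X -> Y) : \bar R :=
  ereal_sup [set (rnorm (T x))%:E | x in [set x : X | (rnorm x <= 1)%R]].

(* The series of the rank one operators is summed in operator norm. *)
Definition nuclear (X Y : normedModType R[i]) (T : {linear X -> Y}) : Prop :=
  exists (xs : nat -> {linear X -> C}) (y : nat -> Y),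
    [/\ (* in particular every xs n is bounded, i.e. lies in the dual of X *)
        \sum_(0 <= n <oo) opnorm (xs n) < +oo,
        exists M : R, forall n, (rnorm (y n) <= M)%R
      & opnorm (fun x => T x - \sum_(n < N) xs n x *: y n)%R
          @[N --> \oo] --> 0].

Definition absolutely_summing (X Y : normedModType R[i]) (T : {linear X -> Y}) :
    Prop :=
  opnorm T < +oo /\
  forall x : nat -> X,
    (forall xs : {linear X -> C}, opnorm xs < +oo ->
       \sum_(0 <= n <oo) (rnorm (xs (x n)))%:E < +oo) ->
    \sum_(0 <= n <oo) (rnorm (T (x n)))%:E < +oo.

End operator_classes.

(* A positive Borel measure on ]0, +oo[ is represented by a Borel measure on R
   of which only the restriction to ]0, +oo[ is used. *)
Section hausdorff_operator.
Context {R : realType} (mu : {measure set (measurableTypeR R) -> \bar R}).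
Local Notation C := (R[i]^o).

Definition hausdorff_moment (n : nat) : \bar R :=
  (\int[mu]_(t in `]0%R, +oo[) (t ^- n.+1)%R%:E)%E.

Definition hausdorff_integrand (f : C -> C) (z : C) (t : R) : C :=
  f (z / t%:C) / t%:C.

Definition hausdorff_integrable (f : C -> C) (z : C) : Prop :=
  mu.-integrable `]0, +oo[
    (fun t => (complex.Re (hausdorff_integrand f z t))%:E) /\
  mu.-integrable `]0, +oo[
    (fun t => (complex.Im (hausdorff_integrand f z t))%:E).

Definition hausdorff (f : C -> C) (z : C) : C :=
  (\int[mu]_(t in `]0, +oo[) complex.Re (hausdorff_integrand f z t)) +i*
  (\int[mu]_(t in `]0, +oo[) complex.Im (hausdorff_integrand f z t)).

(* The Hausdorff operator is well defined as a bounded operator from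
   f^infty_alpha to itself, and T is this operator. *)
Definition is_hausdorff_operator (alpha : R)
    (T : {linear fock_infty alpha -> fock_infty alpha}) : Prop :=
  (forall (f : fock_infty alpha) (z : C),
     hausdorff_integrable f z /\ T f z = hausdorff f z) /\
  (opnorm T < +oo)%E.

End hausdorff_operator.

(* Main.v *)
Require Import Defs.
From HB Require Import structures.
From mathcomp Require Import all_boot all_order all_algebra.
From mathcomp Require Import all_classical all_reals all_analysis.
From mathcomp Require Import measurable_realfun.
From mathcomp Require Import complex.
From mathcomp Require Import ring lra.

(* (i) => (ii).  An entire f is the sum of its Taylor series, with Cauchy estimates
   |a_n| r^n <= 2 sup_{|z| = r} |f|.  Hence |a_n| ||z^n|| <= K ||f|| in f^infty_alpha, and
   since z^n is an eigenvector of H_mu for mu_n, H_mu f = sum_n mu_n a_n z^n is a sum of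
   rank one operators of norm at most K mu_n.  The Cauchy theory is obtained from
   Goursat's lemma on rectangles, applied in the logarithmic plane: the integral of
   f(e^u) e^(-n u) over a vertical period does not depend on the real part of u, which
   gives the estimates, and the same argument for z (f(z) - f(w)) / (z - w) gives
   f(w) = sum_n a_n w^n after expanding z / (z - w).

   (ii) => (iii).  By uniform boundedness a weakly summable sequence (x_k) satisfies
   sum_k |x*(x_k)| <= C ||x*||; then sum the nuclear representation.

   (iii) => (iv).  The monomials x_m = (alpha/2)^m / m! z^(2m) are weakly summable,
   because |x_m(z)| e^(-alpha |z|^2 / 2) are Poisson probabilities, while
   ||H_mu x_m|| = mu_(2m) ||x_m|| and ||x_m|| = m^m e^(-m) / m! is at least of order
   m^(-1/2).  The odd moments are controlled by mu_(n+1) <= mu_n + mu_(n+2). *)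

Set Implicit Arguments.
Unset Strict Implicit.
Unset Printing Implicit Defensive.

Import Order.TTheory GRing.Theory Num.Theory.
Import numFieldNormedType.Exports.

Local Open Scope classical_set_scope.
Local Open Scope complex_scope.
Local Open Scope ring_scope.

(** * Integrals of continuous functions *)

Section primitive.
Context {R : realType}.
Implicit Types h F G : R -> R.

(** All of Cauchy's theory that is used fits into rectangles of height [2 * pi] in the logarithmic
    plane: [cexp] maps vertical segments to circles and the periodic horizontal sides cancel, so no
    general contours or winding numbers occur. A cut along the ray through [w] moves this point to
    the horizontal sides, where a form of Goursat's lemma that asks only for continuity applies. In
    the necessary condition, the exponent [-1/2] is the decay rate of the largest probability of the
    Poisson law of mean [m]; even degrees are used because [|z|^(2m)] is, up to a constant, the
    [m]-th power of the Poisson parameter. *)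

Lemma continuous_primitive h : continuous h ->
  exists F, forall x : R, is_derive x 1 F (h x).
Proof.
move=> hc.
pose I a x := \int[lebesgue_measure]_(t in `[a, x]) h t.
have ih (a b : R) : lebesgue_measure.-integrable `[a, b] (EFin \o h).
  apply: continuous_compact_integrable; first exact: segment_compact.
  exact: continuous_subspaceT.
have dI (a x : R) : a < x -> is_derive x 1 (I a) (h x).
  move=> ax.
  have xx1 : x < x + 1 by rewrite ltrDl.
  have [d e] := continuous_FTC1_closed xx1 (ih a (x + 1)) ax (hc x).
  by apply: DeriveDef; [exact: d|rewrite -derive1E].
have cI (a b x : R) : a <= b -> b <= x -> I a x = I a b + I b x.
  move=> ab bx; apply/eqP; rewrite addrC -subr_eq; apply/eqP.
  rewrite /I Rintegral_itvB//.
  rewrite Rintegral_itv_obnd_cbnd//.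
  by apply: integrableS (ih b x) => //; exact: subset_itv_oc_cc.
(* The integral is differentiable only to the right of its base point, so the base point moves with
   [x] and stays left of both [x] and 0; [FE] shows that the value does not depend on it. *)
pose F (x : R) := I (- `|x| - 1) x - I (- `|x| - 1) 0.
have FE (a x : R) : a < x -> a < 0 -> F x = I a x - I a 0.
  move=> ax a0; rewrite /F; set b := - `|x| - 1.
  have bx : b <= x by rewrite /b; have := ler_normr (-x) x; lra.
  have b0 : b <= 0 by rewrite /b; have := normr_ge0 x; lra.
  have [ab|ba] := leP a b.
    by rewrite (cI a b x)// (cI a b 0)//; ring.
  by rewrite (cI b a x) ?(ltW ba) ?(ltW ax)// (cI b a 0) ?(ltW ba) ?(ltW a0)//; ring.
exists F => x.
pose a := - `|x| - 1.
have ax : a < x by rewrite /a; have := ler_norm (-x); rewrite normrN; lra.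
have a0 : a < 0 by rewrite /a; have := normr_ge0 x; lra.
apply: (@near_eq_is_derive _ _ _ (fun y => I a y - I a 0)).
- near=> y; rewrite (FE a)//.
  by near: y; exact: lt_nbhsr.
- rewrite -[h x]subr0; have := dI a x ax => ?.
  exact: is_deriveB.
Unshelve. all: by end_near. Qed.

(* The oriented integral of [h] as the increment of a primitive, which avoids all
   integrability side conditions; the value is junk if [h] has no primitive. *)
Definition rint h (a b : R) : R :=
  let F := get [set F : R -> R | forall x : R, is_derive x 1 F (h x)] in
  F b - F a.

(** Two primitives differ by a constant, so the one picked by [get] is irrelevant. *)
Lemma rintE h F (a b : R) : (forall x : R, is_derive x 1 F (h x)) ->
  rint h a b = F b - F a.
Proof.
move=> dF; rewrite /rint.
set G := get _.
have dG : forall x : R, is_derive x 1 G (h x).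
  exact: (@getI _ [set F : R -> R | forall x : R, is_derive x 1 F (h x)] F).
have := @is_derive_0_is_cst _ (F - G) a b.
move=> H; have : (F - G) a = (F - G) b.
  apply: H => x; rewrite -(subrr (h x)).
  by have := dF x; have := dG x => ? ?; exact: is_deriveB.
by rewrite !fctE; lra.
Qed.

Lemma rintP h : continuous h -> exists F, (forall x : R, is_derive x 1 F (h x)) /\
  forall a b, rint h a b = F b - F a.
Proof.
by move=> /continuous_primitive[F dF]; exists F; split => // a b; exact: rintE.
Qed.

Lemma rint_chasles h (b a c : R) : rint h a c = rint h a b + rint h b c.
Proof. by rewrite /rint; ring. Qed.

Lemma rintD h1 h2 (a b : R) : continuous h1 -> continuous h2 ->
  rint (fun x => h1 x + h2 x) a b = rint h1 a b + rint h2 a b.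
Proof.
move=> /rintP[F [dF ->]] /rintP[G [dG ->]].
rewrite (@rintE _ (F + G)); first by rewrite !fctE; ring.
Qed.

Lemma rintZ k h (a b : R) : continuous h ->
  rint (fun x => k * h x) a b = k * rint h a b.
Proof.
move=> /rintP[F [dF ->]].
rewrite (@rintE _ (k \*: F)) /=; first by rewrite -mulrBr.
Qed.

Lemma rint_shift h (k a b : R) : continuous h ->
  rint (fun x => h (x + k)) a b = rint h (a + k) (b + k).
Proof.
move=> /rintP[F [dF ->]].
apply: (@rintE _ (F \o shift k)) => x.
rewrite -[h _]mulr1; apply: is_derive1_comp.
exact: is_derive_shift.
Qed.

(** The mean value theorem for a primitive writes the integral as [h c * (b - a)]. *)
Lemma rint_le h (M a b : R) : continuous h -> a <= b ->
  (forall x, a <= x <= b -> `|h x| <= M) -> `|rint h a b| <= M * (b - a).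
Proof.
move=> /rintP[F [dF ->]] ab hM.
have [|c cab ->] := @MVT_segment _ F h a b ab.
- apply: continuous_subspaceT => x.
  by apply/differentiable_continuous/derivable1_diffP; have [] := dF x.
- by rewrite normrM (ger0_norm (_ : 0 <= b - a)) ?subr_ge0// ler_wpM2r ?subr_ge0// hM.
Qed.

Lemma rint_cst (c a b : R) : rint (fun=> c) a b = c * (b - a).
Proof.
have d (x : R) : is_derive x 1 (fun x => c * x) c.
  by rewrite -{2}[c]mulr1; apply: is_deriveZ.
by rewrite (rintE _ _ d) mulrBr.
Qed.

Lemma rint_id (a b : R) : rint (fun x => x) a b = (b ^+ 2 - a ^+ 2) / 2.
Proof.
have d (x : R) : is_derive x 1 (fun x => 2^-1 * x ^+ 2) x.
  apply: is_derive_eq.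
  by rewrite /GRing.scale /=; field.
by rewrite (rintE _ _ d) -mulrBr mulrC.
Qed.

End primitive.

(** * Real-valued modulus on [R[i]], and epsilon-delta forms of limits and derivatives *)

Local Notation normc := ComplexField.Normc.normc.
Section modulus.
Context {R : realType}.
Local Notation C := (R[i]^o).
Local Notation Re := complex.Re.
Local Notation Im := complex.Im.
Implicit Types z w : R[i].

Lemma rnorm_normc (z : C) : rnorm z = normc z. Proof. by []. Qed.

Lemma normc_normr z : `|z| = (normc z)%:C. Proof. by []. Qed.

Lemma normc_ge0 z : 0 <= normc z. Proof. exact: (@rnorm_ge0 _ C z). Qed.

Lemma normc0 : normc (0 : R[i]) = 0. Proof. exact: (@rnorm0 _ C). Qed.

Lemma normc1 : normc (1 : R[i]) = 1. Proof. exact: ComplexField.Normc.normc1. Qed.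

Lemma normcM z w : normc (z * w) = normc z * normc w.
Proof. exact: ComplexField.Normc.normcM. Qed.

Lemma normcV z : normc z^-1 = (normc z)^-1.
Proof. exact: ComplexField.Normc.normcV. Qed.

Lemma normcN z : normc (- z) = normc z.
Proof. exact: (@complex.normcN R z). Qed.

Lemma ler_normcD z w : normc (z + w) <= normc z + normc w.
Proof. exact: (@le_normcD R z w). Qed.

Lemma normc_eq0 z : (normc z == 0) = (z == 0).
Proof.
by apply/eqP/eqP => [/ComplexField.Normc.eq0_normc|->]; rewrite ?normc0.
Qed.

Lemma normc_gt0 z : (0 < normc z) = (z != 0).
Proof. by rewrite lt_def normc_ge0 andbT normc_eq0. Qed.

Lemma normcB z w : normc (z - w) = normc (w - z).
Proof. by rewrite -normcN opprB. Qed.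

Lemma ler_normcB z w : normc z - normc w <= normc (z - w).
Proof. by rewrite lerBlDr -{1}(subrK w z) ler_normcD. Qed.

Lemma normcX z n : normc (z ^+ n) = normc z ^+ n.
Proof. by elim: n => [|n IH]; rewrite ?expr0 ?normc1// !exprS normcM IH. Qed.

Lemma normc_real (x : R) : normc x%:C = `|x|.
Proof. by rewrite /= expr0n addr0 sqrtr_sqr. Qed.

Lemma normc_i : normc ('i%C : R[i]) = 1.
Proof. by rewrite /= expr0n add0r expr1n sqrtr1. Qed.

Lemma normc_Re z : `|Re z| <= normc z.
Proof.
case: z => a b /=; rewrite -sqrtr_sqr ler_sqrt ?addr_ge0 ?sqr_ge0//.
by rewrite lerDl sqr_ge0.
Qed.

Lemma normc_Im z : `|Im z| <= normc z.
Proof.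
case: z => a b /=; rewrite -sqrtr_sqr ler_sqrt ?addr_ge0 ?sqr_ge0//.
by rewrite lerDr sqr_ge0.
Qed.

Lemma normc_ReIm z : normc z <= `|Re z| + `|Im z|.
Proof.
rewrite {1}[z]complexE.
by rewrite (le_trans (ler_normcD _ _))// normcM normc_i mul1r !normc_real.
Qed.

Lemma normc_sum (I : Type) (r : seq I) (P : pred I) (F : I -> R[i]) :
  normc (\sum_(i <- r | P i) F i) <= \sum_(i <- r | P i) normc (F i).
Proof.
elim/big_rec2 : _ => [|i y z _ H]; first by rewrite normc0.
by rewrite (le_trans (ler_normcD _ _))// lerD2l.
Qed.

Lemma ReD z w : Re (z + w) = Re z + Re w. Proof. by case: z w => ? ? [? ?]. Qed.
Lemma ImD z w : Im (z + w) = Im z + Im w. Proof. by case: z w => ? ? [? ?]. Qed.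
Lemma ReN z : Re (- z) = - Re z. Proof. by case: z. Qed.
Lemma ImN z : Im (- z) = - Im z. Proof. by case: z. Qed.
Lemma ReM z w : Re (z * w) = Re z * Re w - Im z * Im w.
Proof. by case: z w => ? ? [? ?]. Qed.
Lemma ImM z w : Im (z * w) = Re z * Im w + Im z * Re w.
Proof. by case: z w => ? ? [? ?]. Qed.

Lemma complex_ext z w : Re z = Re w -> Im z = Im w -> z = w.
Proof. by case: z w => ? ? [? ?] /= -> ->. Qed.

(** Balls have radii in [R[i]]; a positive element there is real, so real radii suffice. *)
Lemma cvgc_lt T (F : set_system T) {FF : Filter F} (f : T -> C) (l : C) :
  (f @ F --> l) <-> forall e : R, 0 < e -> \forall x \near F, normc (l - f x) < e.
Proof.
split=> [/cvgrPdist_lt H e e0|H].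
  have /H : 0 < e%:C by rewrite ltcR.
  by apply: filterS => x; rewrite normc_normr ltcR.
apply/cvgrPdist_lt => e.
case: e => a b; rewrite ltcE /= => /andP[/eqP -> a0].
by apply: filterS (H a a0) => x; rewrite normc_normr ltcR.
Qed.

Lemma cvg_ReIm T (F : set_system T) {FF : Filter F} (f : T -> C) (l : C) :
  (f @ F --> l) <->
  ((fun x => Re (f x)) @ F --> Re l) /\ ((fun x => Im (f x)) @ F --> Im l).
Proof.
split=> [/cvgc_lt H|[Hr Hi]].
  split; apply/cvgrPdist_lt => e /H; apply: filterS => x; apply: le_lt_trans.
    by rewrite (le_trans _ (normc_Re _))// ReD ReN.
  by rewrite (le_trans _ (normc_Im _))// ImD ImN.
apply/cvgc_lt => e e0; have e20 : 0 < e / 2 by rewrite divr_gt0.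
near=> x; apply: le_lt_trans (normc_ReIm _) _.
rewrite (splitr e) ltrD// ?ReD ?ReN ?ImD ?ImN; near: x.
  by move/cvgrPdist_lt : Hr; exact.
by move/cvgrPdist_lt : Hi; exact.
Unshelve. all: by end_near. Qed.

Lemma continuousc_lt (f : C -> C) (z : C) : {for z, continuous f} <->
  forall e : R, 0 < e -> exists2 d : R, 0 < d &
    forall w, normc (w - z) < d -> normc (f w - f z) < e.
Proof.
split=> [/cvgc_lt H e /H|H].
  move=> /nbhs_ballP[d d0 dH].
  move: d0 dH; case: d => d i; rewrite /= ltcE /= => /andP[/eqP -> d0] dH.
  exists d => // w wz; rewrite normcB; apply: dH.
  by rewrite -ball_normE /= normc_normr ltcR normcB.
apply/(@cvgc_lt _ (nbhs z)) => e /H[d d0 dH]; apply/nbhs_ballP; exists d%:C; first by rewrite /= ltcR.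
move=> w; rewrite -ball_normE /= normc_normr ltcR normcB => wz.
by rewrite normcB; apply: dH.
Qed.

Lemma continuous_cD (T : topologicalType) (f g : T -> C) :
  continuous f -> continuous g -> continuous (fun x => f x + g x).
Proof. by move=> c1 c2 x; apply: cvgD; [exact: c1|exact: c2]. Qed.

Lemma continuous_cB (T : topologicalType) (f g : T -> C) :
  continuous f -> continuous g -> continuous (fun x => f x - g x).
Proof. by move=> c1 c2 x; apply: cvgB; [exact: c1|exact: c2]. Qed.

Lemma continuous_cM (T : topologicalType) (f g : T -> C) :
  continuous f -> continuous g -> continuous (fun x => f x * g x).
Proof. by move=> c1 c2 x; apply: cvgM; [exact: c1|exact: c2]. Qed.

Lemma continuous_cst (T U : topologicalType) (k : U) : continuous (fun _ : T => k).
Proof. by move=> x; exact: cvg_cst. Qed.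

Lemma continuous_id (T : topologicalType) : continuous (fun x : T => x).
Proof. by move=> x; exact: cvg_id. Qed.

(** Multiplying out the difference quotient removes the punctured neighbourhood and the division.
    Goursat's estimate and the differentiation of power series use this form. *)
Lemma derivablec_lt (f : C -> C) (z : C) : derivable f z 1 <->
  exists l : C, forall e : R, 0 < e -> exists2 d : R, 0 < d &
    forall w, normc (w - z) < d ->
      normc (f w - f z - l * (w - z)) <= e * normc (w - z).
Proof.
have dE (d : R) (P : set C) : (0 < d) -> (forall h : C, h != 0 -> normc h < d -> P h) ->
    (0 : C)^' P.
  move=> d0 H; apply/nbhs_ballP; exists d%:C; first by rewrite /= ltcR.
  move=> h; rewrite -ball_normE /= sub0r normrN normc_normr ltcR => hd h0.
  exact: H.
split=> [/cvg_ex[/= l /cvgc_lt H]|[l H]].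
  exists l => e e0.
  move: (H e e0) => /nbhs_ballP[d d0 dH].
  move: d0 dH; case: d => d i; rewrite /= ltcE /= => /andP[/eqP -> d0] dH.
  exists d => // w wz.
  have [->|wz0] := eqVneq w z.
    by rewrite !subrr mulr0 subr0 normc0 mulr0.
  have wz1 : w - z != 0 by rewrite subr_eq0.
  have : normc (l - (w - z)^-1 *: (f ((w - z) *: (1:C) + z) - f z)) < e.
    apply: dH => //=.
    by rewrite -ball_normE /= sub0r normrN normc_normr ltcR.
  rewrite [_ *: (1 : C)]mulr1 subrK => H1.
  have -> : f w - f z - l * (w - z) =
      - (l - (w - z)^-1 *: (f w - f z)) * (w - z).
    rewrite opprB mulrBl; congr (_ - _).
    by rewrite [X in X * _]mulrC mulfVK.
  by rewrite normcM normcN ler_wpM2r ?normc_ge0// ltW.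
apply/cvg_ex; exists l; apply/cvgc_lt => e e0.
have e20 : 0 < e / 2 by rewrite divr_gt0.
have [d d0 dH] := H _ e20.
apply: (dE d) => // h h0 hd.
rewrite [_ *: (1 : C)]mulr1.
have hw : normc ((h + z) - z) < d by rewrite addrK.
have := dH _ hw; rewrite addrK => H1.
have -> : l - h^-1 *: (f (h + z) - f z) = - ((f (h + z) - f z - l * h) * h^-1).
  rewrite mulrBl mulfK// opprB; congr (_ - _); exact: mulrC.
rewrite normcN normcM normcV ltr_pdivrMr ?normc_gt0//.
rewrite (le_lt_trans H1)// ltr_pM2r ?normc_gt0//.
by rewrite ltr_pdivrMr// ltr_pMr// ltr1n.
Qed.

Lemma derivable_cM (f g : C -> C) (z : C) : derivable f z 1 -> derivable g z 1 ->
  derivable (fun z : C => f z * g z : C) z 1.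
Proof. by move=> df dg; exact: (@derivableM _ _ f g z 1 df dg). Qed.

Lemma derivable_cB (f g : C -> C) (z : C) : derivable f z 1 -> derivable g z 1 ->
  derivable (fun z : C => f z - g z : C) z 1.
Proof. by move=> df dg; exact: (@derivableB _ _ _ f g z 1 df dg). Qed.

Lemma derivable_cV (f : C -> C) (z : C) : f z != 0 -> derivable f z 1 ->
  derivable (fun z : C => (f z)^-1 : C) z 1.
Proof. by move=> f0 df; exact: (@derivableV _ _ f z 1 f0 df). Qed.

Lemma derivable_cX (n : nat) (z : C) : derivable (fun z : C => z ^+ n : C) z 1.
Proof.
elim: n => [|n IH].
  have -> : (fun z : C => z ^+ 0 : C) = cst 1 by apply/funext => w; rewrite expr0.
  exact: derivable_cst.
have -> : (fun z : C => z ^+ n.+1 : C) = (fun z : C => z * z ^+ n).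
  by apply/funext => w; rewrite exprS.
by apply: (@derivable_cM (fun z : C => z) (fun z : C => z ^+ n : C) z _ IH); exact: derivable_id.
Qed.

End modulus.

#[local] Arguments ComplexField.Normc.normc {R} x : simpl never.

(** * Complex integrals along segments and around rectangles *)

Section complex_integral.
Context {R : realType}.
Local Notation C := (R[i]^o).
Local Notation Re := complex.Re.
Local Notation Im := complex.Im.
Implicit Types (h : R -> C) (k : R[i]).

Definition cint h (a b : R) : R[i] :=
  rint (fun x => Re (h x)) a b +i* rint (fun x => Im (h x)) a b.

Lemma continuous_Re h : continuous h -> continuous (fun x => Re (h x)).
Proof. by move=> hc x; have [+ _] := (@cvg_ReIm _ _ (nbhs x) _ h (h x)).1 (hc x). Qed.

Lemma continuous_Im h : continuous h -> continuous (fun x => Im (h x)).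
Proof. by move=> hc x; have [_ +] := (@cvg_ReIm _ _ (nbhs x) _ h (h x)).1 (hc x). Qed.

Lemma continuous_ReIm h : continuous (fun x => Re (h x)) ->
  continuous (fun x => Im (h x)) -> continuous h.
Proof. by move=> hr hi x; apply/(@cvg_ReIm _ _ (nbhs x)); split; [exact: hr|exact: hi]. Qed.

Lemma cint_chasles h (b a c : R) : cint h a c = cint h a b + cint h b c.
Proof.
by apply: complex_ext; rewrite ?ReD ?ImD /= -rint_chasles.
Qed.

Lemma cintD h1 h2 (a b : R) : continuous h1 -> continuous h2 ->
  cint (fun x => h1 x + h2 x) a b = cint h1 a b + cint h2 a b.
Proof.
move=> c1 c2; apply: complex_ext; rewrite ?ReD ?ImD /=.
  under [X in rint X _ _]funext => x do rewrite ReD.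
  by rewrite rintD//; exact: continuous_Re.
under [X in rint X _ _]funext => x do rewrite ImD.
by rewrite rintD//; exact: continuous_Im.
Qed.

Lemma cintZ k h (a b : R) : continuous h ->
  cint (fun x => k * h x) a b = k * cint h a b.
Proof.
move=> c; have cr := continuous_Re c; have ci := continuous_Im c.
have cZ (l : R) (f : R -> R) : continuous f -> continuous (fun x => l * f x).
  by move=> fc x; apply: continuousM; [exact: cst_continuous|exact: fc].
apply: complex_ext; rewrite ?ReM ?ImM /=.
  under [X in rint X _ _]funext => x do rewrite ReM -mulNr.
  by rewrite rintD ?rintZ ?mulNr//; exact: cZ.
under [X in rint X _ _]funext => x do rewrite ImM.
by rewrite rintD ?rintZ//; exact: cZ.
Qed.

Lemma cint_shift h (l a b : R) : continuous h ->
  cint (fun x => h (x + l)) a b = cint h (a + l) (b + l).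
Proof.
move=> c; rewrite /cint (@rint_shift _ (fun x => Re (h x))) ?(@rint_shift _ (fun x => Im (h x)))//.
  exact: continuous_Im.
exact: continuous_Re.
Qed.

(** Real and imaginary parts are bounded separately, since the mean value theorem is a real
    statement. The resulting factor 2 persists up to the Cauchy estimates. *)
Lemma cint_le h (M a b : R) : continuous h -> a <= b ->
  (forall x, a <= x <= b -> normc (h x) <= M) ->
  normc (cint h a b) <= 2 * M * (b - a).
Proof.
move=> c ab hM; apply: le_trans (normc_ReIm _) _.
rewrite -mulrA mulr_natl mulr2n lerD//=; apply: rint_le => //.
- exact: continuous_Re.
- by move=> x /hM; apply: le_trans; exact: normc_Re.
- exact: continuous_Im.
- by move=> x /hM; apply: le_trans; exact: normc_Im.
Qed.

Lemma cint_cst k (a b : R) : cint (fun=> k) a b = k * (b - a)%:C.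
Proof. by apply: complex_ext; rewrite ?ReM ?ImM /= rint_cst; ring. Qed.

Lemma cint_id (a b : R) : cint (fun x => x%:C) a b = ((b ^+ 2 - a ^+ 2) / 2)%:C.
Proof. by apply: complex_ext; rewrite /= ?rint_id// rint_cst mul0r. Qed.

Lemma continuous_real_complex : continuous (fun x : R => x%:C : C).
Proof.
by apply: continuous_ReIm => x /=; [exact: cvg_id|exact: cvg_cst].
Qed.

Definition horiz (g : C -> C) (y a b : R) := cint (fun x => g (x +i* y)) a b.
Definition vert (g : C -> C) (x c d : R) := cint (fun y => g (x +i* y)) c d.

(** Counterclockwise boundary integral of [g(z) dz]: [dz] is [dx] on the horizontal sides and [i dy]
    on the vertical ones. *)
Definition rectint (g : C -> C) (a b c d : R) : R[i] :=
  horiz g c a b - horiz g d a b + 'i%C * (vert g b c d - vert g a c d).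

Lemma continuous_horiz (g : C -> C) (y : R) : continuous g ->
  continuous (fun x : R => g (x +i* y)).
Proof.
move=> gc x; apply: (@continuous_comp _ _ _ (fun x : R => (x +i* y) : C) g); last exact: gc.
by apply: continuous_ReIm x => x /=; [exact: cvg_id|exact: cvg_cst].
Qed.

Lemma continuous_vert (g : C -> C) (x : R) : continuous g ->
  continuous (fun y : R => g (x +i* y)).
Proof.
move=> gc y; apply: (@continuous_comp _ _ _ (fun y : R => (x +i* y) : C) g); last exact: gc.
by apply: continuous_ReIm y => y /=; [exact: cvg_cst|exact: cvg_id].
Qed.

Lemma rectint_splitx g (a b c d m : R) :
  rectint g a b c d = rectint g a m c d + rectint g m b c d.
Proof.
rewrite /rectint /horiz /vert !(cint_chasles _ m a b).
by ring.
Qed.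

Lemma rectint_splity g (a b c d m : R) :
  rectint g a b c d = rectint g a b c m + rectint g a b m d.
Proof.
rewrite /rectint /horiz /vert !(cint_chasles _ m c d).
by ring.
Qed.

Lemma rectintD g1 g2 (a b c d : R) : continuous g1 -> continuous g2 ->
  rectint (fun z => g1 z + g2 z) a b c d = rectint g1 a b c d + rectint g2 a b c d.
Proof.
move=> c1 c2; rewrite /rectint /horiz /vert.
have H y := cintD a b (@continuous_horiz g1 y c1) (@continuous_horiz g2 y c2).
have V x := cintD c d (@continuous_vert g1 x c1) (@continuous_vert g2 x c2).
by rewrite !H !V; ring.
Qed.

(** Computed directly: this is the part of [g] that the derivative removes in Goursat's lemma. *)
Lemma rectint_affine (k l : R[i]) (a b c d : R) :
  rectint (fun z => k * z + l) a b c d = 0.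
Proof.
have E (p q : R[i]) (u v : R) : cint (fun x => q + p * x%:C) u v =
    q * (v - u)%:C + p * ((v ^+ 2 - u ^+ 2) / 2)%:C.
  rewrite cintD ?cintZ ?cint_cst ?cint_id//.
  - exact: continuous_real_complex.
  - by move=> x; exact: cvg_cst.
  - by apply: continuous_cM; [move=> x; exact: cvg_cst|exact: continuous_real_complex].
have EH (y : R) : horiz (fun z => k * z + l) y a b = 
    (l + k * 'i%C * y%:C) * (b - a)%:C + k * ((b ^+ 2 - a ^+ 2) / 2)%:C.
  rewrite -E /horiz; congr cint; apply/funext => x.
  by rewrite [x +i* y]complexE /=; ring.
have EV (x : R) : vert (fun z => k * z + l) x c d = 
    (l + k * x%:C) * (d - c)%:C + k * 'i%C * ((d ^+ 2 - c ^+ 2) / 2)%:C.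
  rewrite -E /vert; congr cint; apply/funext => y.
  by rewrite [x +i* y]complexE /=; ring.
rewrite /rectint !EH !EV.
rewrite !rmorphB/=.
have i2 := sqr_i R.
by ring: i2.
Qed.

Lemma rectint_le (g : C -> C) (M a b c d : R) : continuous g -> a <= b -> c <= d ->
  (forall x y, a <= x <= b -> c <= y <= d -> normc (g (x +i* y)) <= M) ->
  normc (rectint g a b c d) <= 4 * M * ((b - a) + (d - c)).
Proof.
move=> gc ab cd gM.
have H y : c <= y <= d -> normc (horiz g y a b) <= 2 * M * (b - a).
  by move=> yd; apply: cint_le => // [|x xb]; [exact: continuous_horiz|exact: gM].
have V x : a <= x <= b -> normc (vert g x c d) <= 2 * M * (d - c).
  by move=> xb; apply: cint_le => // [|y yd]; [exact: continuous_vert|exact: gM].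
have := H c; rewrite lexx cd => /(_ isT) H1.
have := H d; rewrite lexx cd => /(_ isT) H2.
have := V a; rewrite lexx ab => /(_ isT) V1.
have := V b; rewrite lexx ab => /(_ isT) V2.
rewrite /rectint.
have := ler_normcD (horiz g c a b - horiz g d a b) ('i%C * (vert g b c d - vert g a c d)).
rewrite normcM normc_i mul1r.
have := ler_normcD (horiz g c a b) (- horiz g d a b).
have := ler_normcD (vert g b c d) (- vert g a c d).
rewrite !normcN; lra.
Qed.

End complex_integral.

#[local] Arguments rint : simpl never.
#[local] Arguments cint : simpl never.
#[local] Arguments horiz : simpl never.
#[local] Arguments vert : simpl never.
#[local] Arguments rectint : simpl never.

(** * Goursat's lemma *)

Section goursat.
Context {R : realType}.
Local Notation C := (R[i]^o).

Let q k : R := 2^-1 ^+ k.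
Let q_gt0 k : 0 < q k. Proof. by rewrite exprn_gt0// invr_gt0. Qed.
Let qS k : q k = q k.+1 + q k.+1.
Proof. by rewrite /q exprS; lra. Qed.

(** The supremum of the left endpoints works, because every left endpoint lies below every right
    endpoint. *)
Lemma nested_segments (x : nat -> R) (w : R) : 0 <= w ->
  (forall k, x k <= x k.+1 /\ x k.+1 + w * q k.+1 <= x k + w * q k) ->
  exists p, forall k, x k <= p <= x k + w * q k.
Proof.
move=> w0 H.
have xm : {homo x : m n / (m <= n)%N >-> m <= n}.
  by apply: homo_leq => [//|y u v|k]; [exact: le_trans|have [] := H k].
have xd : {homo (fun k => x k + w * q k) : m n / (m <= n)%N >-> n <= m}.
  by apply: homo_leq => [//|y u v yu vy|k]; [exact: le_trans vy yu|have [] := H k].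
have xx j k : x j <= x k + w * q k.
  have [jk|/ltnW kj] := leqP j k.
    by rewrite (le_trans (xm _ _ jk))// lerDl mulr_ge0// ltW.
  by rewrite (le_trans _ (xd _ _ kj))// lerDl mulr_ge0// ltW.
exists (sup (range x)) => k; apply/andP; split.
  apply: ub_le_sup; last by exists k.
  by exists (x 0%N + w * q 0) => _ [j _ <-].
apply: ge_sup; first by exists (x 0%N), 0%N.
by move=> _ [j _ <-].
Qed.

(** Bisection: if the integral has modulus [E > 0], some quarter always keeps a fourth of it. At the
    limit point, [g] minus its affine part is at most [e] times the distance, so the integral over
    the [k]-th rectangle is of order [e * 4^-k], too small for small [e]. Continuity on the whole
    plane ensures that all the side integrals have primitives. *)
Lemma goursat (g : C -> C) (a b c d : R) : a <= b -> c <= d -> continuous g ->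
  (forall x y : R, a <= x <= b -> c <= y <= d -> derivable g (x +i* y) 1) ->
  rectint g a b c d = 0.
Proof.
move=> ab cd gc dg; apply: contrapT => /eqP; rewrite -normc_gt0.
set w := b - a; set h := d - c.
have w0 : 0 <= w by rewrite subr_ge0.
have h0 : 0 <= h by rewrite subr_ge0.
pose N (p : R * R) k := normc (rectint g p.1 (p.1 + w * q k) p.2 (p.2 + h * q k)).
have -> : normc (rectint g a b c d) = N (a, c) 0%N.
  by rewrite /N /q /= expr0 !mulr1 /w /h (addrC a) (addrC c) !subrK.
set E := N _ _ => E0.
have step (pk : (R * R) * nat) : exists p' : R * R,
    [/\ pk.1.1 <= p'.1 /\ p'.1 + w * q pk.2.+1 <= pk.1.1 + w * q pk.2,
        pk.1.2 <= p'.2 /\ p'.2 + h * q pk.2.+1 <= pk.1.2 + h * q pk.2 &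
        N pk.1 pk.2 <= 4 * N p' pk.2.+1].
  case: pk => -[x y] k /=.
  pose u := w * q k.+1; pose v := h * q k.+1.
  have u0 : 0 <= u by rewrite mulr_ge0// ltW.
  have v0 : 0 <= v by rewrite mulr_ge0// ltW.
  have uE : w * q k = u + u by rewrite qS mulrDr.
  have vE : h * q k = v + v by rewrite qS mulrDr.
  have H4 (r1 r2 r3 r4 : R[i]) : normc ((r1 + r2) + (r3 + r4)) <=
      normc r1 + normc r3 + normc r2 + normc r4.
    rewrite [X in normc X]addrA.
    have := ler_normcD (r1 + r2 + r3) r4; have := ler_normcD (r1 + r2) r3.
    have := ler_normcD r1 r2; lra.
  have NE : N (x, y) k <= N (x, y) k.+1 + N (x + u, y) k.+1 + N (x, y + v) k.+1
      + N (x + u, y + v) k.+1.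
    rewrite /N /= uE vE -/u -/v (rectint_splitx _ _ _ _ _ (x + u)).
    rewrite [X in X + _](rectint_splity _ _ _ _ _ (y + v)).
    rewrite [X in _ + X](rectint_splity _ _ _ _ _ (y + v)) [x + (_ + _)]addrA [y + (_ + _)]addrA.
exact: H4.
  rewrite uE vE -/u -/v.
  (* If three quarters fall short, the sum bound [NE] forces the fourth to be large. *)
  have [N1|N1] := leP (N (x, y) k) (4 * N (x, y) k.+1).
    by exists (x, y); split => //=; split; lra.
  have [N2|N2] := leP (N (x, y) k) (4 * N (x + u, y) k.+1).
    by exists (x + u, y); split => //=; split; lra.
  have [N3|N3] := leP (N (x, y) k) (4 * N (x, y + v) k.+1).
    by exists (x, y + v); split => //=; split; lra.
  by exists (x + u, y + v); split => //=; [split; lra..|lra].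
move/choice : step => [f fP].
pose s := fix s k := if k is j.+1 then f (s j, j) else (a, c).
have sS k : s k.+1 = f (s k, k) by [].
have EN k : E <= 4 ^+ k * N (s k) k.
  elim: k => [|k IH]; first by rewrite expr0 mul1r.
  have [_ _] := fP (s k, k); rewrite -sS /= => H.
  by rewrite (le_trans IH)// exprSr -mulrA ler_wpM2l// exprn_ge0.
have [k|px pxP] := @nested_segments (fun k => (s k).1) w w0.
  by have [+ _ _] := fP (s k, k).
have [k|py pyP] := @nested_segments (fun k => (s k).2) h h0.
  by have [_ + _] := fP (s k, k).
have /derivablec_lt[l lP] : derivable g (px +i* py) 1.
  apply: dg.
    by have := pxP 0%N; rewrite /= /q expr0 mulr1 /w addrC subrK.
  by have := pyP 0%N; rewrite /= /q expr0 mulr1 /h addrC subrK.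
pose D := w + h.
have D0 : 0 <= D by rewrite addr_ge0.
(* The estimates end in [E <= 4 * e * D ^+ 2], which this [e] contradicts; the [+ 1] covers
   [D = 0]. *)
have e0 : 0 < E / (8 * D ^+ 2 + 1).
  by rewrite divr_gt0// ltr_wpDl// mulr_ge0// sqr_ge0.
have [del del0 delP] := lP _ e0.
have [k kd] : exists k, D * q k < del.
  have := @cvg_geometric R D 2^-1.
  rewrite ger0_norm ?invr_ge0// invf_lt1// ltr1n => /(_ isT).
  move=> /cvgrPdist_lt/(_ _ del0)[k _ /(_ k (leqnn k))].
  rewrite sub0r normrN /= => H; exists k; apply: le_lt_trans H; exact: ler_norm.
set e := E / _ in e0 delP.
have : N (s k) k <= 4 * (e * (D * q k)) * (w * q k + h * q k).
  rewrite /N; set x := (s k).1; set y := (s k).2.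
  pose p := px +i* py.
  (* The affine part has zero boundary integral, so only the first-order error is left. *)
  have gE : g = fun z => (g z - g p - l * (z - p)) + (l * z + (g p - l * p)).
    by apply/funext => z; rewrite mulrBr; ring.
  have sc (k' : C) : continuous (fun z : C => z - k').
    exact: (@continuous_cB _ C id (fun=> k') (@continuous_id C) (@continuous_cst C C k')).
  have lc (k' : C) : continuous (fun z : C => l * z + k').
    apply: (@continuous_cD _ C (fun z => l * z) (fun=> k')); last exact: continuous_cst.
    by apply: (@continuous_cM _ C (fun=> l) id); [exact: continuous_cst|exact: continuous_id].
  have g'c : continuous (fun z : C => g z - g p - l * (z - p) : C).
    apply: (@continuous_cB _ C (fun z => g z - g p) (fun z => l * (z - p))).
      apply: (@continuous_cB _ C g (fun=> g p)); [exact: gc|exact: continuous_cst].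
    by apply: (@continuous_cM _ C (fun=> l) (fun z => z - p)); [exact: continuous_cst|exact: sc].
  rewrite gE (rectintD _ _ _ _ g'c (lc _)) rectint_affine addr0.
  have -> : w * q k + h * q k = x + w * q k - x + (y + h * q k - y) by ring.
  apply: rectint_le => //.
  - by rewrite lerDl mulr_ge0// ltW.
  - by rewrite lerDl mulr_ge0// ltW.
  - move=> x' y' xx' yy'.
    have zp : normc ((x' +i* y') - p) <= D * q k.
      rewrite (le_trans (normc_ReIm _))// ReD ReN ImD ImN /= /D mulrDl.
      have := pxP k; have := pyP k; rewrite -/x -/y => /andP[? ?] /andP[? ?].
      by rewrite lerD// ler_norml; lra.
    rewrite (le_trans (delP _ _))//; first exact: le_lt_trans kd.
    by rewrite ler_wpM2l// ltW.
move=> H.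
have : E <= 4 * e * D ^+ 2.
  rewrite (le_trans (EN k))//.
  have -> : 4 * e * D ^+ 2 = 4 ^+ k * (4 * (e * (D * q k)) * (w * q k + h * q k)).
    have q4 : 4 ^+ k * (q k * q k) = 1.
      by rewrite /q -!exprMn (_ : 4 * (2^-1 / 2) = 1 :> R) ?expr1n//; field.
    rewrite -mulrDl -/D; transitivity (4 ^+ k * (q k * q k) * (4 * e * D ^+ 2)).
      by rewrite q4 mul1r.
    by ring.
  by rewrite ler_wpM2l// exprn_ge0.
rewrite /e.
have : 0 < 8 * D ^+ 2 + 1 by rewrite ltr_wpDl// mulr_ge0// sqr_ge0.
move=> P0; have -> : 4 * (E / (8 * D ^+ 2 + 1)) * D ^+ 2 = E * (4 * D ^+ 2) / (8 * D ^+ 2 + 1).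
  by ring.
rewrite ler_pdivlMr// ler_pM2l//.
have := sqr_ge0 D; lra.
Qed.

End goursat.

(** * Goursat's lemma with mere continuity on the horizontal sides *)

Section goursat_open.
Context {R : realType}.
Local Notation C := (R[i]^o).

(** Tube lemma: compactness of [[a, b]] makes continuity in [y] uniform in [x]. *)
Lemma horiz_near (g : C -> C) (a b y e : R) : continuous g -> 0 < e ->
  \forall y' \near y, forall x, a <= x <= b ->
    normc (g (x +i* y) - g (x +i* y')) <= e.
Proof.
move=> gc e0.
have /compact_near_coveringP H := @segment_compact R a b.
have := H R (nbhs y) (fun y' x => normc (g (x +i* y) - g (x +i* y')) <= e) _.
move=> /(_ (nbhs_filter y)) H1; suff: \forall y' \near y,
    `[a, b] `<=` (fun x => normc (g (x +i* y) - g (x +i* y')) <= e).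
  by apply: filterS => y' + x xab; apply; rewrite /= in_itv.
apply: H1 => x _.
have [d d0 dP] := (continuousc_lt g (x +i* y)).1 (gc (x +i* y)) (e / 2) (divr_gt0 e0 (ltr0n _ 2)).
have d20 : 0 < d / 2 by rewrite divr_gt0.
exists ([set x' | `|x - x'| < d / 2], [set y' | `|y - y'| < d / 2]).
  by split => /=; [exact: (@nbhsx_ballx _ R^o x)|exact: (@nbhsx_ballx _ R^o y)].
case=> x' y' /= [xx' yy'].
have := dP (x' +i* y'); have := dP (x' +i* y).
rewrite (le_lt_trans (normc_ReIm _)) => [/(_ isT) H2|]; last first.
  by rewrite ReD ReN ImD ImN /= subrr normr0 addr0 distrC; lra.
rewrite (le_lt_trans (normc_ReIm _)) => [/(_ isT) H3|]; last first.
  by rewrite ReD ReN ImD ImN /= distrC [`|y' - y|]distrC; lra.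
have := ler_normcD (g (x' +i* y) - g (x +i* y)) (- (g (x' +i* y') - g (x +i* y))).
have -> : g (x' +i* y) - g (x +i* y) - (g (x' +i* y') - g (x +i* y)) =
  g (x' +i* y) - g (x' +i* y') by ring.
by rewrite normcN; lra.
Qed.

Lemma cintB (h1 h2 : R -> C) (a b : R) : continuous h1 -> continuous h2 ->
  cint (fun x => h1 x - h2 x) a b = cint h1 a b - cint h2 a b.
Proof.
move=> c1 c2.
under [X in cint X]funext => x do rewrite -mulN1r.
have c3 : continuous (fun x => -1 * h2 x).
  exact: (@continuous_cM _ _ (fun=> -1) h2 (@continuous_cst _ _ _) c2).
by rewrite (cintD a b c1 c3) cintZ// mulN1r.
Qed.

Lemma horiz_continuous (g : C -> C) (a b : R) : a <= b -> continuous g ->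
  continuous (fun y => horiz g y a b : C).
Proof.
move=> ab gc y; apply/(@cvgc_lt _ _ (nbhs y)) => e e0.
have D0 : 0 < 2 * (b - a) + 1 by lra.
have := horiz_near a b y gc (divr_gt0 e0 D0).
apply: filterS => y' H; rewrite /horiz -cintB//; try exact: continuous_horiz.
apply: (@le_lt_trans _ _ (2 * (e / (2 * (b - a) + 1)) * (b - a))).
  apply: cint_le => //.
  move=> x; apply: cvgB; exact: continuous_horiz.
have -> : 2 * (e / (2 * (b - a) + 1)) * (b - a) = e * (2 * (b - a)) / (2 * (b - a) + 1).
  by ring.
by rewrite ltr_pdivrMr// ltr_pM2l//; lra.
Qed.

Lemma rint_continuous (h : R -> R) (a : R) : continuous h -> continuous (rint h a).
Proof.
move=> /rintP[F [dF E]].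
have -> : rint h a = (fun b => F b - F a) by apply/funext => b; exact: E.
move=> x; apply: cvgB; last exact: cvg_cst.
by apply/differentiable_continuous/derivable1_diffP; have [] := dF x.
Qed.

Lemma cint_continuous (h : R -> C) (a : R) : continuous h ->
  continuous (cint h a : R -> C).
Proof.
move=> hc; apply: continuous_ReIm; apply: rint_continuous.
  exact: continuous_Re.
exact: continuous_Im.
Qed.

Lemma rectint_continuous (g : C -> C) (a b c : R) : a <= b -> continuous g ->
  continuous (rectint g a b c : R -> C).
Proof.
move=> ab gc.
apply: (@continuous_cD _ _ (fun d => horiz g c a b - horiz g d a b)
    (fun d => 'i%C * (vert g b c d - vert g a c d))).
  apply: (@continuous_cB _ _ (fun=> horiz g c a b) (fun d => horiz g d a b)).
    exact: continuous_cst.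
  exact: horiz_continuous.
apply: (@continuous_cM _ _ (fun=> 'i%C) (fun d => vert g b c d - vert g a c d)).
  exact: continuous_cst.
by apply: (@continuous_cB _ _ (vert g b c) (vert g a c));
  apply: cint_continuous; exact: continuous_vert.
Qed.

Lemma rectintC (g : C -> C) (a b c d : R) : rectint g a b d c = - rectint g a b c d.
Proof.
have cC h (u v : R) : cint h u v = - cint h v u :> R[i].
  by rewrite /cint /rint; apply: complex_ext => /=; ring.
by rewrite /rectint /vert (cC _ d c) (cC _ d c); ring.
Qed.

Lemma continuous_eq0_right (f : R -> C) (c d : R) : c < d -> continuous f ->
  (forall x, c < x < d -> f x = 0) -> f c = 0.
Proof.
move=> cd fc f0; apply: contrapT => /eqP; rewrite -normc_gt0 => E0.
have H := (@cvgc_lt _ _ (nbhs c) _ f (f c)).1 (fc c) _ E0.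
near c^'+ => x.
have : normc (f c - f x) < normc (f c).
  by near: x; apply: cvg_within; exact: H.
have cx : c < x by near: x; exact: nbhs_right_gt.
have xd : x < d by near: x; exact: nbhs_right_lt.
by rewrite (f0 x) ?cx ?xd// subr0 ltxx.
Unshelve. all: by end_near. Qed.

Lemma continuous_eq0_left (f : R -> C) (c d : R) : c < d -> continuous f ->
  (forall x, c < x < d -> f x = 0) -> f d = 0.
Proof.
move=> cd fc f0; have := @continuous_eq0_right (f \o -%R) (- d) (- c).
rewrite /= opprK; apply; first by rewrite ltrN2.
  by move=> x; apply: continuous_comp; [exact: opp_continuous|exact: fc].
by move=> x /andP[? ?]; apply: f0; lra.
Qed.

(** The closed version applies when both horizontal sides lie strictly inside. The integral is
    continuous in the height of each side, so its vanishing passes to the limit, one side at a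
    time. *)
Lemma goursat_open (g : C -> C) (a b c d : R) : a <= b -> c < d -> continuous g ->
  (forall x y : R, a <= x <= b -> c < y < d -> derivable g (x +i* y) 1) ->
  rectint g a b c d = 0.
Proof.
move=> ab cd gc dg.
apply: (@continuous_eq0_left (rectint g a b c) c d) => //.
  exact: rectint_continuous.
move=> d' /andP[cd' d'd]; rewrite -[LHS]opprK -rectintC; apply/eqP.
rewrite oppr_eq0; apply/eqP.
apply: (@continuous_eq0_right (rectint g a b d') c d') => //.
  exact: rectint_continuous.
move=> c' /andP[cc' c'd']; rewrite rectintC goursat ?oppr0 ?(ltW c'd')// => x y xab yy.
by apply: dg => //; lra.
Qed.

End goursat_open.

(** * The complex exponential *)

Section complex_exponential.
Context {R : realType}.
Local Notation C := (R[i]^o).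
Local Notation Re := complex.Re.
Local Notation Im := complex.Im.

Lemma is_derive_lt (f : R -> R) (x l e : R) : is_derive x 1 f l -> 0 < e ->
  exists2 d : R, 0 < d &
    forall h, `|h| < d -> `|f (x + h) - f x - l * h| <= e * `|h|.
Proof.
move=> [/cvg_ex[l' H] E] e0.
have {}E : l' = l by rewrite -E; apply/esym/cvg_lim.
move: H; rewrite E => /cvgrPdist_lt/(_ e e0)/nbhs_ballP[d /= d0 dH].
exists d => // h hd.
have [->|h0] := eqVneq h 0; first by rewrite addr0 subrr sub0r mulr0 oppr0 !normr0 mulr0.
have : `|l - h^-1 *: (f (h *: 1 + x) - f x)| < e.
  apply: dH => //; rewrite -ball_normE /= sub0r normrN//.
rewrite [h *: 1]mulr1 => H1.
have -> : f (x + h) - f x - l * h = - (l - h^-1 *: (f (h + x) - f x)) * h.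
  by rewrite opprB mulrBl [x + h]addrC [_ *: _]mulrC mulfVK.
by rewrite normrM normrN ler_wpM2r// ltW.
Qed.

Definition cexp (z : C) : C :=
  (expR (Re z) * cos (Im z)) +i* (expR (Re z) * sin (Im z)).

Lemma cexp0 : cexp 0 = 1.
Proof. by rewrite /cexp /= expR0 cos0 sin0 mulr1 mulr0. Qed.

Lemma cexpD (z w : R[i]) : cexp (z + w) = cexp z * cexp w.
Proof.
apply: complex_ext; rewrite ?ReM ?ImM /= ReD ImD expRD ?cosD ?sinD; ring.
Qed.

Lemma normc_cexp (z : R[i]) : normc (cexp z) = expR (Re z).
Proof.
rewrite /ComplexField.Normc.normc /= !exprMn -mulrDr cos2Dsin2 mulr1 sqrtr_sqr.
by rewrite ger0_norm// expR_ge0.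
Qed.

Lemma cexp_neq0 (z : R[i]) : cexp z != 0.
Proof. by rewrite -normc_gt0 normc_cexp expR_gt0. Qed.

Lemma cexpN (z : R[i]) : cexp (- z) = (cexp z)^-1.
Proof.
apply: (mulfI (cexp_neq0 z)).
by rewrite -cexpD subrr cexp0 mulfV ?cexp_neq0.
Qed.

Lemma cexp_period (x y : R) : cexp (x +i* (y + 2 * pi)) = cexp (x +i* y).
Proof.
by rewrite /cexp /= mulr_natl cosD sinD cos2pi sin2pi !mulr0 !mulr1 subr0 addr0.
Qed.

(** This is the derivative at 0, assembled from the real exponential, cosine and sine; [cexpD]
    carries it to every point. *)
Lemma cexp_small (e : R) : 0 < e -> exists2 d : R, 0 < d &
  forall h : R[i], normc h < d -> normc (cexp h - 1 - h) <= e * normc h.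
Proof.
(* The error terms below add up to [9 * m * r]; [m <= 1] keeps [expR x] at most 3. *)
move=> e0; pose m := Num.min (e / 9) 1.
have m0 : 0 < m by rewrite lt_min divr_gt0// ltr01.
have m1 : m <= 1 by rewrite ge_min lexx orbT.
have me : 9 * m <= e by rewrite mulrC -ler_pdivlMr// ge_min lexx.
clearbody m.
have [d1 d10 H1] := is_derive_lt (is_derive_expR (0 : R)) m0.
have [d2 d20 H2] := is_derive_lt (is_derive_cos (0 : R)) m0.
have [d3 d30 H3] := is_derive_lt (is_derive_sin (0 : R)) m0.
exists (Num.min d1 (Num.min d2 (Num.min d3 m))); first by rewrite !lt_min d10 d20 d30.
move=> h; rewrite !lt_min => /and4P[hd1 hd2 hd3 hm].
have := normc_Re h; have := normc_Im h.
set x := Re h; set y := Im h; set r := normc h in hm * => yr xr.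
have {}H1 : `|expR x - 1 - x| <= m * r.
  have := H1 x; rewrite add0r expR0 mul1r => H; apply: le_trans (H _) _.
    exact: le_lt_trans xr hd1.
  by rewrite ler_wpM2l// ltW.
have {}H2 : `|cos y - 1| <= m * r.
  have := H2 y; rewrite add0r cos0 sin0 oppr0 mul0r subr0 => H; apply: le_trans (H _) _.
    exact: le_lt_trans yr hd2.
  by rewrite ler_wpM2l// ltW.
have {}H3 : `|sin y - y| <= m * r.
  have := H3 y; rewrite add0r cos0 sin0 subr0 mul1r => H; apply: le_trans (H _) _.
    exact: le_lt_trans yr hd3.
  by rewrite ler_wpM2l// ltW.
have r0 : 0 <= r by exact: normc_ge0.
have r1 : r <= 1 by lra.
have mr : m * r <= 1 by rewrite mulr_ile1// ltW.
have ex : `|expR x| <= 3.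
  rewrite ger0_norm ?expR_ge0//.
  by move: H1 xr; rewrite !ler_norml; lra.
have ex1 : `|expR x - 1| <= 2 * m.
  have : m * r <= m * 1 by rewrite ler_wpM2l// ltW.
  by move: H1 xr; rewrite !ler_norml; lra.
apply: le_trans (normc_ReIm _) _.
rewrite !ReD !ImD !ReN !ImN /= -/x -/y subr0.
have -> : expR x * cos y - 1 - x = (expR x - 1 - x) + expR x * (cos y - 1) by ring.
have -> : expR x * sin y - y = expR x * (sin y - y) + (expR x - 1) * y by ring.
apply: (@le_trans _ _ (m * r + 3 * (m * r) + (3 * (m * r) + 2 * m * r))).
  apply: lerD; apply: le_trans (ler_normD _ _) _; apply: lerD => //;
    by rewrite normrM ler_pM.
have -> : m * r + 3 * (m * r) + (3 * (m * r) + 2 * m * r) = 9 * m * r by ring.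
by rewrite ler_wpM2r.
Qed.

Lemma derivable_cexp (z : C) : derivable (cexp : C -> C) z 1.
Proof.
apply/derivablec_lt; exists (cexp z) => e e0.
have k0 : 0 < normc (cexp z) by rewrite normc_gt0 cexp_neq0.
have [d d0 H] := cexp_small (divr_gt0 e0 k0).
exists d => // w wz.
rewrite -{1}(subrK z w) [w - z + z]addrC cexpD.
have -> : cexp z * cexp (w - z) - cexp z - cexp z * (w - z) =
  cexp z * (cexp (w - z) - 1 - (w - z)) by ring.
rewrite normcM mulrC -ler_pdivlMr//.
by rewrite mulrAC; apply: H.
Qed.

(** The argument is the [acos] of the normalized real part, with the sign of the imaginary part. The
    case [w = 0] is included so that every [w] has a direction along which to cut. *)
Lemma polar (w : R[i]) : exists t : R, w = (normc w)%:C * cexp (0 +i* t).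
Proof.
have [->|w0] := eqVneq w 0; first by exists 0; rewrite normc0 mul0r.
have n0 : 0 < normc w by rewrite normc_gt0.
pose x := Re w / normc w; pose y := Im w / normc w.
have xy : x ^+ 2 + y ^+ 2 = 1.
  have E : normc w ^+ 2 = Re w ^+ 2 + Im w ^+ 2.
    rewrite /ComplexField.Normc.normc; case: (w) => u v /=.
    by rewrite sqr_sqrtr// addr_ge0// sqr_ge0.
  by rewrite /x /y !expr_div_n -mulrDl -E mulfV// sqrf_eq0 gt_eqF.
have x1 : -1 <= x <= 1.
  rewrite -ler_norml -sqrtr_sqr -sqrtr1 ler_sqrt// -xy lerDl; exact: sqr_ge0.
have E (t : R) : cos t = x -> sin t = y -> w = (normc w)%:C * cexp (0 +i* t).
  move=> ct st; apply: complex_ext; rewrite ?ReM ?ImM /= expR0 ct st mul0r ?subr0 ?addr0 mul1r.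
    by rewrite /x mulrC divfK// gt_eqF.
  by rewrite /y mulrC divfK// gt_eqF.
have sx : Num.sqrt (1 - x ^+ 2) = `|y| by rewrite -xy addrC addKr sqrtr_sqr.
have [y0|y0] := leP 0 y.
  by exists (acos x); apply: E; rewrite ?acosK// sin_acos// sx ger0_norm.
exists (- acos x); apply: E; rewrite ?cosN ?acosK// sinN sin_acos// sx ltr0_norm//.
by rewrite opprK.
Qed.

(** Equality would force [cos (y - t) = 1], hence a zero of the sine at [(y - t) / 2], which lies
    strictly between 0 and [pi]. *)
Lemma cexp_polar_inj (r t x y : R) : 0 <= r -> t < y < t + 2 * pi ->
  cexp (x +i* y) != r%:C * cexp (0 +i* t).
Proof.
move=> r0 /andP[ty yt]; apply/eqP => E.
have rE : expR x = r.
  have := congr1 (fun z => normc z) E.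
  by rewrite normcM !normc_cexp normc_real /= expR0 mulr1 ger0_norm.
have E2 : cexp (0 +i* (y - t)) = 1.
  have rx : r%:C != 0 :> R[i] by rewrite -rE -normc_gt0 normc_real normr_gt0 gt_eqF// expR_gt0.
  apply: (mulfI rx).
  have -> : 0 +i* (y - t) = (0 +i* y) - (0 +i* t) :> R[i] by simpc.
  rewrite cexpD cexpN mulrA mulr1.
  have -> : r%:C * cexp (0 +i* y) = cexp (x +i* y).
    by apply: complex_ext; rewrite ?ReM ?ImM /= expR0 rE !mul1r mul0r ?subr0 ?addr0.
  by rewrite E mulfK// cexp_neq0.
have := congr1 (fun z => Re z) E2; rewrite /= expR0 mul1r.
have -> : y - t = ((y - t) / 2) *+ 2 by rewrite -mulr_natr divfK.
rewrite cos_mulr2n => /eqP; rewrite -subr_eq0.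
have s0 : 0 < sin ((y - t) / 2) by apply: sin_gt0_pi; lra.
have := cos2Dsin2 ((y - t) / 2).
have : 0 < sin ((y - t) / 2) ^+ 2 by rewrite exprn_gt0.
rewrite -mulr_natl => ? ? /eqP; lra.
Qed.

End complex_exponential.

(** * Integrals over circles, written in the logarithmic plane *)

Section circle_integral.
Context {R : realType}.
Local Notation C := (R[i]^o).
Local Notation Re := complex.Re.
Local Notation Im := complex.Im.
Implicit Types F : C -> C.

Lemma derivable_continuous F (z : C) : derivable F z 1 -> {for z, continuous F}.
Proof. by move=> d; apply/differentiable_continuous/derivable1_diffP. Qed.

Lemma continuous_cexp : continuous (cexp : C -> C).
Proof. by move=> z; apply: derivable_continuous; exact: derivable_cexp. Qed.

Lemma derivable_comp_cexp F (z : C) : derivable F (cexp z) 1 ->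
  derivable (fun u : C => F (cexp u) : C) z 1.
Proof.
move=> /derivable1_diffP dF; apply/derivable1_diffP.
have /derivable1_diffP dc : derivable (cexp : C -> C) z 1 by exact: derivable_cexp.
exact: (@differentiable_comp _ _ _ _ cexp F z dc dF).
Qed.

Lemma cint_periodic (h : R -> C) (T t : R) : continuous h ->
  (forall x, h (x + T) = h x) -> cint h t (t + T) = cint h 0 T.
Proof.
move=> hc hT; rewrite (cint_chasles h 0 t) (cint_chasles h T 0).
have -> : cint h T (t + T) = cint h 0 t.
  have := cint_shift T 0 t hc; rewrite add0r => <-; congr cint.
  by apply/funext => x; rewrite hT.
have -> : cint h t 0 = - cint h 0 t :> R[i].
  by rewrite /cint /rint; apply: complex_ext => /=; ring.
by ring.
Qed.

(* The circle of radius [e^x], cut at the argument [t], is a vertical segment of the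
   logarithmic plane. *)
Definition circ F (x t : R) : R[i] := vert (F \o cexp) x t (t + 2 * pi).

Lemma circ_shift F (x t : R) : continuous (F \o cexp) -> circ F x t = circ F x 0.
Proof.
move=> c; rewrite /circ /vert add0r; apply: cint_periodic.
  exact: continuous_vert.
by move=> y; rewrite /= cexp_period.
Qed.

(** In the rectangle [[a, b] x [t, t + 2 pi]] the horizontal sides cancel by periodicity, and
    Goursat's lemma equates the two vertical ones. *)
Lemma circ_const F (t a b : R) : a <= b -> continuous (F \o cexp) ->
  (forall x y, t < y < t + 2 * pi -> derivable F (cexp (x +i* y)) 1) ->
  circ F a t = circ F b t.
Proof.
move=> ab c d.
have pi0 : 0 < pi :> R := pi_gt0 R.
have tt : t < t + 2 * pi by lra.
have := goursat_open ab tt c; rewrite /rectint.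
have -> : horiz (F \o cexp) (t + 2 * pi) a b = horiz (F \o cexp) t a b.
  by rewrite /horiz; congr cint; apply/funext => x /=; rewrite cexp_period.
rewrite subrr add0r => /(_ _)/eqP; rewrite mulf_eq0 subr_eq0 => H.
have /orP[/eqP i0|/eqP//] := H (fun x y _ yt => derivable_comp_cexp (d x y yt)).
by have := @normc_i R; rewrite i0 normc0 => /eqP; rewrite eq_sym oner_eq0.
Qed.

Lemma circ_le F (x t M : R) : continuous (F \o cexp) ->
  (forall z, normc z = expR x -> normc (F z) <= M) ->
  normc (circ F x t) <= 4 * pi * M.
Proof.
move=> c H; have pi0 : 0 < pi :> R := pi_gt0 R.
have -> : 4 * pi * M = 2 * M * (t + 2 * pi - t) by ring.
apply: cint_le; [exact: (continuous_vert c)|lra|].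
by move=> y _; apply: H; rewrite normc_cexp.
Qed.

Lemma circD F1 F2 (x t : R) : continuous (F1 \o cexp) -> continuous (F2 \o cexp) ->
  circ (fun z => F1 z + F2 z) x t = circ F1 x t + circ F2 x t.
Proof.
by move=> c1 c2; rewrite /circ /vert cintD//; [exact: (continuous_vert c1)|exact: (continuous_vert c2)].
Qed.

Lemma circZ (k : R[i]) F (x t : R) : continuous (F \o cexp) ->
  circ (fun z => k * F z) x t = k * circ F x t.
Proof.
by move=> c; rewrite /circ /vert cintZ//; exact: (continuous_vert c).
Qed.

Lemma circ0 (x t : R) : circ (fun=> 0) x t = 0.
Proof. by rewrite /circ /vert cint_cst mul0r. Qed.

Lemma circ1 (x t : R) : circ (fun=> 1) x t = (2 * pi)%:C.
Proof. by rewrite /circ /vert cint_cst mul1r; congr (_%:C); ring. Qed.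

Lemma continuous_csum (T : topologicalType) (G : nat -> T -> C) N :
  (forall n, continuous (G n)) -> continuous (fun z => \sum_(n < N) G n z : C).
Proof.
move=> c; elim: N => [|N IH].
  by under [X in continuous X]funext => z do rewrite big_ord0; exact: continuous_cst.
under [X in continuous X]funext => z do rewrite big_ord_recr.
exact: (@continuous_cD _ _ (fun z => \sum_(n < N) G n z) (G N) IH (c N)).
Qed.

Lemma circ_sum (G : nat -> C -> C) N (x t : R) :
  (forall n, continuous (G n \o cexp)) ->
  circ (fun z => \sum_(n < N) G n z) x t = \sum_(n < N) circ (G n) x t.
Proof.
move=> c; elim: N => [|N IH].
  under [X in circ X]funext => z do rewrite big_ord0.
  by rewrite circ0 big_ord0.
under [X in circ X]funext => z do rewrite big_ord_recr.
rewrite (@circD (fun z => \sum_(i < N) G i z) (G N))// ?IH ?big_ord_recr//.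
exact: (continuous_csum c).
Qed.

End circle_integral.

(** * Taylor expansion of entire functions *)

Section taylor.
Context {R : realType}.
Local Notation C := (R[i]^o).
Implicit Types f g : C -> C.

Let twopi0 : (2 * pi)%:C != 0 :> R[i].
Proof. by rewrite -normc_gt0 normc_real normr_gt0 mulf_neq0// gt_eqF// pi_gt0. Qed.

(** Cauchy's formula on the unit circle. The power is [n] and not [n + 1] because [dz = i z dy] in
    the logarithmic variable. *)
Definition coef f n : R[i] :=
  ((2 * pi)%:C)^-1 * circ (fun z => f z / z ^+ n) 0 0.

Lemma derivable_divX f n (z : C) : derivable f z 1 -> z != 0 ->
  derivable (fun z => f z / z ^+ n : C) z 1.
Proof.
move=> df z0; have zn0 : z ^+ n != 0 by rewrite expf_neq0.
have dV := @derivable_cV _ (fun z => z ^+ n) z zn0 (@derivable_cX R n z).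
exact: (@derivable_cM _ f (fun z => (z ^+ n)^-1) z df dV).
Qed.

Lemma entire_divX_continuous f n : entire f ->
  continuous ((fun z => f z / z ^+ n : C) \o cexp).
Proof.
move=> ef z; apply: derivable_continuous.
apply: (@derivable_comp_cexp _ (fun z => f z / z ^+ n)).
by apply: derivable_divX; [exact: ef|exact: cexp_neq0].
Qed.

Lemma circ_coef f n (x t : R) : entire f ->
  circ (fun z => f z / z ^+ n) x t = (2 * pi)%:C * coef f n.
Proof.
move=> ef; have c := @entire_divX_continuous f n ef.
rewrite /coef mulVKf// (circ_shift _ _ c).
have d y z (_ : 0 < z < 0 + 2 * pi) : derivable (fun z => f z / z ^+ n : C) (cexp (y +i* z)) 1.
  by apply: derivable_divX; [exact: ef|exact: cexp_neq0].
by have [x0|/ltW x0] := leP x 0; rewrite (circ_const x0 c d).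
Qed.

Lemma coef_le f n (r M : R) : entire f -> 0 < r ->
  (forall z, normc z = r -> normc (f z) <= M) ->
  normc (coef f n) * r ^+ n <= 2 * M.
Proof.
move=> ef r0 fM.
have rE : expR (ln r) = r by rewrite lnK.
have pi0 : 0 < pi :> R := pi_gt0 R.
have := @circ_le _ (fun z => f z / z ^+ n) (ln r) 0 (M / r ^+ n) (entire_divX_continuous ef).
rewrite circ_coef// normcM normc_real ger0_norm ?mulr_ge0 ?pi_ge0// => H.
rewrite -ler_pdivlMr ?exprn_gt0// -mulrA.
have p2 : 0 < 2 * pi :> R by rewrite mulr_gt0.
rewrite -(ler_pM2l p2).
have -> : 2 * pi * (2 * (M / r ^+ n)) = 4 * pi * (M / r ^+ n) by ring.
apply: H => z; rewrite rE => zr.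
rewrite normcM normcV normcX zr ler_wpM2r//; last exact: fM.
by rewrite invr_ge0 exprn_ge0// ltW.
Qed.

Lemma coefD f g n : entire f -> entire g ->
  coef (fun z => f z + g z) n = coef f n + coef g n.
Proof.
move=> ef eg; rewrite /coef.
have -> : (fun z => (f z + g z) / z ^+ n) = (fun z => f z / z ^+ n + g z / z ^+ n).
  by apply/funext => z; rewrite mulrDl.
by rewrite (circD 0 0 (@entire_divX_continuous f n ef) (@entire_divX_continuous g n eg)) mulrDr.
Qed.

Lemma coefZ (k : R[i]) f n : entire f -> coef (fun z => k * f z) n = k * coef f n.
Proof.
move=> ef; rewrite /coef.
have -> : (fun z => k * f z / z ^+ n) = (fun z => k * (f z / z ^+ n)).
  by apply/funext => z; rewrite mulrA.
by rewrite (circZ k 0 0 (@entire_divX_continuous f n ef)) mulrCA.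
Qed.

Lemma entire_cst (k : C) : entire (fun=> k).
Proof. by move=> z; exact: derivable_cst. Qed.

(** For positive index the Cauchy estimate at large radii forces the coefficient to vanish, so no
    trigonometric integral is computed. *)
Lemma coef_cst (k : R[i]) n : coef (fun=> k) n = if n is 0 then k else 0.
Proof.
have -> : coef (fun=> k) n = k * coef (fun=> 1) n.
  rewrite -coefZ; last exact: entire_cst.
  by congr (coef _ n); apply/funext => z; rewrite mulr1.
case: n => [|n].
  rewrite /coef.
  have -> : (fun z : C => 1 / z ^+ 0) = (fun=> 1).
    by apply/funext => z; rewrite expr0 divr1.
  by rewrite circ1 mulVf// mulr1.
suff -> : coef (fun=> 1) n.+1 = 0 by rewrite mulr0.
apply/eqP; rewrite -normc_eq0; set c := normc _.
have c0 : 0 <= c by exact: normc_ge0.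
rewrite eq_le c0 andbT leNgt; apply/negP => c1.
(* With radius [r = 2 / c + 1] one has [c * r = 2 + c], above the Cauchy bound 2; as [r >= 1],
   higher powers are no smaller. *)
have r1 : 1 <= 2 / c + 1 by rewrite lerDr divr_ge0.
have H : c * (2 / c + 1) ^+ n.+1 <= 2 * 1.
  apply: coef_le; [exact: entire_cst|exact: lt_le_trans r1|].
  by move=> z _; rewrite normc1.
have : c * (2 / c + 1) <= 2.
  rewrite (le_trans _ (le_trans H _)) ?mulr1//.
  by rewrite ler_wpM2l// exprS ler_peMr ?exprn_ege1// (le_trans ler01).
by rewrite mulrDr mulr1 mulrC divfK ?gt_eqF//; lra.
Qed.

Lemma derivable_slope f (w z : C) : entire f -> z != w ->
  derivable (fun z => (f z - f w) / (z - w) : C) z 1.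
Proof.
move=> ef zw.
have d1 : derivable (fun z => f z - f w : C) z 1.
  exact: (@derivable_cB _ f (fun=> f w) z (ef z) (derivable_cst _ _ _)).
have d2 : derivable (fun z => z - w : C) z 1.
  by apply: (@derivable_cB _ (fun z : C => z) (fun=> w) z); [exact: derivable_id|exact: derivable_cst].
have zw0 : z - w != 0 by rewrite subr_eq0.
have dV := @derivable_cV _ (fun z => z - w) z zw0 d2.
exact: (@derivable_cM _ (fun z => f z - f w) (fun z => (z - w)^-1) z d1 dV).
Qed.

(** The value at [w] is the derivative of [f], which gives continuity there. *)
Lemma slope_extension f (w : C) : entire f -> exists p : C -> C,
  [/\ continuous p, forall z, f z - f w = p z * (z - w) &
      forall z, z != w -> derivable p z 1].
Proof.
move=> ef; have [l lP] := (derivablec_lt f w).1 (ef w).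
pose p z : C := if z == w then l else (f z - f w) / (z - w).
have npz z : z != w -> \forall u \near z, (f u - f w) / (u - w) = p u.
  move=> zw.
  have zw0 : 0 < normc (z - w) by rewrite normc_gt0 subr_eq0.
  apply/nbhs_ballP; exists (normc (z - w))%:C; first by rewrite /= ltcR.
  move=> u; rewrite -ball_normE /= normc_normr ltcR /p.
  by have [->|//] := eqVneq u w; rewrite ltxx.
have dp z : z != w -> derivable p z 1.
  move=> zw; apply: (@near_eq_derivable _ _ _ (fun u => (f u - f w) / (u - w)) p).
    exact: npz.
  exact: derivable_slope.
exists p; split; [move=> z|move=> z|exact: dp]; last first.
  by rewrite /p; have [->|zw] := eqVneq z w; rewrite ?subrr ?mulr0// divfK// subr_eq0.
have [->|zw] := eqVneq z w; last exact: derivable_continuous (dp z zw).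
apply/continuousc_lt => e e0; have [d d0 dP] := lP (e / 2) (divr_gt0 e0 (ltr0n _ 2)).
exists d => // u uw; rewrite /p eqxx.
have [_|uw0] := eqVneq u w; first by rewrite subrr normc0.
have n0 : 0 < normc (u - w) by rewrite normc_gt0 subr_eq0.
have -> : (f u - f w) / (u - w) - l = (f u - f w - l * (u - w)) / (u - w).
  by rewrite [RHS]mulrBl mulfK// subr_eq0.
rewrite normcM normcV ltr_pdivrMr// (le_lt_trans (dP u uw))// ltr_pM2r//; lra.
Qed.

Lemma circ_ext (F1 F2 : C -> C) (x t : R) :
  (forall z, normc z = expR x -> F1 z = F2 z) -> circ F1 x t = circ F2 x t.
Proof.
move=> H; rewrite /circ /vert; congr cint; apply/funext => y /=.
by apply: H; rewrite normc_cexp.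
Qed.

Lemma comp_continuous (F : C -> C) : continuous F -> continuous (F \o cexp).
Proof.
by move=> Fc z; apply: (@continuous_comp _ _ _ cexp F); [exact: continuous_cexp|exact: Fc].
Qed.

(* The circle of integration is cut at an argument of [w], so that the pole of the
   slope at [w] lies on the horizontal sides in the logarithmic plane. *)
Lemma circ_slope (p : C -> C) (w : C) (x : R) : continuous p ->
  (forall z, z != w -> derivable p z 1) -> circ (fun z => p z * z) x 0 = 0.
Proof.
move=> pc dp; set F := fun z => _.
have Fc : continuous F by apply: (@continuous_cM _ _ p id pc); exact: continuous_id.
have Fe := comp_continuous Fc.
have [t wt] := polar w.
rewrite -(circ_shift x t Fe).
have dF a y : t < y < t + 2 * pi -> derivable F (cexp (a +i* y)) 1.
  move=> ty; apply: (@derivable_cM _ p (fun z => z)); last exact: derivable_id.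
  by apply: dp; rewrite wt; apply: cexp_polar_inj => //; exact: normc_ge0.
have FE a : circ F a t = circ F x t.
  have [ax|/ltW ax] := leP a x; first exact: (circ_const ax Fe (fun a => dF a)).
  by apply/esym; exact: (circ_const ax Fe (fun a => dF a)).
apply/eqP; rewrite -normc_eq0; set J := normc _.
have J0 : 0 <= J by exact: normc_ge0.
rewrite eq_le J0 andbT leNgt; apply/negP => J1.
have [d d0 dP] := (continuousc_lt p 0).1 (pc 0) 1 ltr01.
(* The integral is the same for all radii, while the factor [z] makes it small on small circles:
   [|p| <= K] near 0, and the radius [s] brings the bound down to [J / 2]. *)
pose K := normc (p 0) + 1.
have K0 : 0 < K by rewrite ltr_wpDl// normc_ge0.
have pi0 : 0 < pi :> R := pi_gt0 R.
have K4 : 0 < 8 * pi * K by rewrite !mulr_gt0.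
pose s := Num.min (d / 2) (J / (8 * pi * K)).
have s0 : 0 < s by rewrite lt_min !divr_gt0.
have sd : s <= d / 2 by rewrite ge_min lexx.
have sJ : s * (8 * pi * K) <= J by rewrite -ler_pdivlMr// ge_min lexx orbT.
clearbody s.
have : J <= 4 * pi * (K * s).
  rewrite /J -(FE (ln s)); apply: circ_le => // z; rewrite lnK// => zs.
  rewrite normcM zs ler_wpM2r ?(ltW s0)//.
  have := dP z; rewrite subr0 zs => /(_ _); have := ler_normcB (p z) (p 0).
  rewrite /K => H1 H2; have /H2 : s < d by lra.
  lra.
have -> : 4 * pi * (K * s) = s * (8 * pi * K) / 2 by field.
lra.
Qed.

(** The remainder is kept exactly, so that only finite sums are exchanged with the circle
    integral. *)
Lemma geometric_remainder (w z : R[i]) N : z != 0 -> z != w ->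
  z / (z - w) = \sum_(n < N) w ^+ n / z ^+ n + (w / z) ^+ N * (z / (z - w)).
Proof.
move=> z0 zw; have zw0 : z - w != 0 by rewrite subr_eq0.
elim: N => [|N IH]; first by rewrite big_ord0 add0r expr0 mul1r.
rewrite {1}IH big_ord_recr -addrA; congr (_ + _).
rewrite exprS expr_div_n.
have -> : w / z * (w ^+ N / z ^+ N) * (z / (z - w)) = (w ^+ N / z ^+ N) * (w / (z - w)).
  by rewrite mulrACA; field; rewrite z0 zw0 expf_neq0.
rewrite -{2}[w ^+ N / z ^+ N]mulr1 -mulrDr; congr (_ * _).
by field.
Qed.

(** The integral of [(f z - f w) * z / (z - w)] over a circle around [w] and 0 vanishes by
    [circ_slope]. Expanding [z / (z - w)] turns it into [2 * pi] times the difference of the Taylor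
    sum and [f w], plus a geometrically small remainder. *)
Lemma taylor f (w : C) : entire f ->
  (fun N => \sum_(n < N) coef f n * w ^+ n : C) @ \oo --> f w.
Proof.
move=> ef; have [p [pc pE dp]] := slope_extension w ef.
(* On this circle [|z - w| >= 1], and [|w| / r < 1] drives the remainder to 0. *)
pose r := normc w + 1.
have r0 : 0 < r by rewrite ltr_wpDl// normc_ge0.
pose b := ln r.
have bE : expR b = r by rewrite lnK.
have pi0 : 0 < pi :> R := pi_gt0 R.
have [B HB] := entire_bounded_disc r ef.
pose F z : C := p z * z.
have Fc : continuous F by apply: (@continuous_cM _ _ p id pc); exact: continuous_id.
have zr z : normc z = r -> z != 0 /\ 1 <= normc (z - w).
  move=> zr; split; first by rewrite -normc_gt0 zr.
  by have := ler_normcB z w; rewrite zr /r; lra.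
have zw z : normc z = r -> z != w.
  by move=> /zr[_]; have [->|//] := eqVneq z w; rewrite subrr normc0 ler10.
have FE z : normc z = r -> F z = (f z - f w) * (z / (z - w)).
  by move=> /zw z1; rewrite pE /F; field; rewrite subr_eq0.
have F0 : circ F b 0 = 0 by exact: (circ_slope b pc dp).
have FM z : normc z = r -> normc (F z) <= 2 * B * r.
  move=> nz; have [_ z1] := zr z nz.
  rewrite FE// !normcM normcV nz.
  have := HB z; have := HB w; rewrite !rnorm_normc nz lexx => H1 /(_ isT) H2.
  have {}H1 := H1 (_ : normc w <= r).
  have f2 : normc (f z - f w) <= 2 * B.
    have := ler_normcD (f z) (- f w); rewrite normcN.
    by have := H1 ltac:(rewrite /r; lra); lra.
  apply: ler_pM => //; rewrite ?normc_ge0//.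
    by rewrite divr_ge0 ?normc_ge0// ltW.
  by rewrite ler_pdivrMr ?ler_peMr// ?(ltW r0)//; exact: lt_le_trans z1.
(* The sum is nonempty because subtracting [f w] affects only the coefficient of index 0. The
   constant is [4 * pi * (2 * B * r)] divided by [2 * pi]. *)
have key N : normc (f w - \sum_(n < N.+1) coef f n * w ^+ n) <=
    4 * B * r * (normc w / r) ^+ N.+1.
  pose G n z : C := w ^+ n * ((f z + - f w) / z ^+ n).
  pose E z : C := (w / z) ^+ N.+1 * F z.
  have efw : entire (fun z => f z + - f w).
    by move=> z; apply: (@derivable_cB _ f (fun=> f w)); [exact: ef|exact: derivable_cst].
  have Gc n : continuous (G n \o cexp).
    apply: (@continuous_cM _ _ (fun=> w ^+ n) ((fun z => (f z + - f w) / z ^+ n) \o cexp)).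
      exact: continuous_cst.
    exact: entire_divX_continuous.
  have Ec : continuous (E \o cexp).
    have w1 : entire (fun=> w ^+ N.+1) by exact: entire_cst.
    apply: (@continuous_cM _ _ (fun u => (w / cexp u) ^+ N.+1) (F \o cexp)).
      have := @entire_divX_continuous _ N.+1 w1.
      by under [X in _ -> continuous X]funext => u do rewrite expr_div_n.
    exact: comp_continuous.
  have GE n : circ (G n) b 0 = (2 * pi)%:C * (coef f n * w ^+ n - (if n is 0%N then f w else 0)).
    rewrite (circZ _ _ _ (entire_divX_continuous efw)) circ_coef//.
    rewrite (coefD n ef (@entire_cst (- f w))) coef_cst.
    by case: n => [|n]; rewrite ?expr0; ring.
  have : circ F b 0 = circ (fun z => \sum_(n < N.+1) G n z + E z) b 0.
    apply: circ_ext => z; rewrite bE => nz.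
    have [z0 _] := zr z nz.
    rewrite FE// (geometric_remainder N.+1 z0 (zw z nz)) mulrDr /E FE//.
    congr (_ + _); last by ring.
    by rewrite big_distrr; apply: eq_bigr => n _; rewrite /G /=; ring.
  rewrite F0 (@circD _ (fun z => \sum_(n < N.+1) G n z) E b 0 (continuous_csum Gc) Ec).
  rewrite circ_sum//.
  under eq_bigr do rewrite GE.
  rewrite -big_distrr /= sumrB.
  have -> : \sum_(i < N.+1) (if nat_of_ord i is 0%N then f w else 0) = f w.
    by rewrite big_ord_recl /= big1 ?addr0.
  move=> H; have {}H : (2 * pi)%:C * (f w - \sum_(n < N.+1) coef f n * w ^+ n) = circ E b 0.
    apply: (addrI ((2 * pi)%:C * (\sum_(n < N.+1) coef f n * w ^+ n - f w))).
    by rewrite -H; ring.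
  have : normc (circ E b 0) <= 4 * pi * ((normc w / r) ^+ N.+1 * (2 * B * r)).
    apply: circ_le => // z; rewrite bE => nz.
    rewrite normcM normcX normcM normcV nz; apply: ler_pM => //.
    - by rewrite exprn_ge0// divr_ge0 ?normc_ge0// ltW.
    - exact: normc_ge0.
    - exact: FM.
  rewrite -H normcM normc_real ger0_norm; last by rewrite mulr_ge0// pi_ge0.
  have p2 : 0 < 2 * pi :> R by rewrite mulr_gt0.
  move=> HE; rewrite -(ler_pM2l p2) (le_trans HE)// le_eqVlt; apply/orP; left.
  by apply/eqP; ring.
apply/cvgc_lt => e e0.
have q1 : `|normc w / r| < 1.
  rewrite ger0_norm ?divr_ge0 ?normc_ge0 ?(ltW r0)//.
  by rewrite ltr_pdivrMr// mul1r ltrDl.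
have := @cvg_geometric R (4 * B * r) _ q1.
move=> /cvgrPdist_lt/(_ e e0)[k _ kP].
exists k.+1 => // -[//|N] /= kN; rewrite (le_lt_trans (key N))//.
have := kP N.+1 (ltnW kN); rewrite sub0r normrN /geometric /=.
by apply: le_lt_trans; exact: ler_norm.
Qed.

End taylor.

(** * Operator norms and convergence of series *)

Section bounded_operators.
Context {R : realType}.
Local Notation C := (R[i]^o).

(** Translates extended-real series into uniform bounds on real partial sums, the form in which the
    estimates are made. *)
Lemma nneseries_ltyP (u : nat -> R) : (forall n, 0 <= u n) ->
  (\sum_(0 <= n <oo) (u n)%:E < +oo)%E <->
  exists M : R, forall N, \sum_(n < N) u n <= M.
Proof.
move=> u0; have uE0 n : (0 <= (u n)%:E)%E by rewrite lee_fin.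
split=> [uoo|[M HM]].
  have s0 : (0 <= \sum_(0 <= n <oo) (u n)%:E)%E by apply: nneseries_ge0.
  exists (fine (\sum_(0 <= n <oo) (u n)%:E)%E) => N.
  rewrite -lee_fin fineK ?ge0_fin_numE// -sumEFin -(big_mkord xpredT (fun n => (u n)%:E)).
  exact: nneseries_lim_ge.
apply: (@le_lt_trans _ _ M%:E); last exact: ltry.
apply: lime_le; first exact: is_cvg_nneseries.
apply: nearW => N; rewrite big_mkord sumEFin lee_fin; exact: HM.
Qed.

Section opnorm.
Variables (X Y : normedModType R[i]).

Lemma rnorm_scale (a : R) (x : X) : rnorm (a%:C *: x) = `|a| * rnorm x.
Proof. by rewrite rnormZ rnorm_normc normc_real. Qed.

Lemma rnormN (x : X) : rnorm (- x) = rnorm x.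
Proof. by rewrite /rnorm normrN. Qed.

Lemma rnorm_sum (I : Type) (r : seq I) (P : pred I) (F : I -> X) :
  rnorm (\sum_(i <- r | P i) F i) <= \sum_(i <- r | P i) rnorm (F i).
Proof.
elim/big_rec2 : _ => [|i y z _ H]; first by rewrite rnorm0.
by rewrite (le_trans (rnormD _ _))// lerD2l.
Qed.

Lemma opnorm_ge0 (T : X -> Y) : (0 <= opnorm T)%E.
Proof.
apply: (@le_trans _ _ (rnorm (T 0))%:E); first by rewrite lee_fin rnorm_ge0.
by apply: ereal_sup_ubound; exists 0 => //=; rewrite rnorm0.
Qed.

Lemma opnorm_le (T : X -> Y) (c : R) : 0 <= c ->
  (forall x, rnorm (T x) <= c * rnorm x) -> (opnorm T <= c%:E)%E.
Proof.
move=> c0 H; apply: ge_ereal_sup => _ [x /= x1 <-].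
by rewrite lee_fin (le_trans (H x))// ler_piMr.
Qed.

(** Homogeneity is assumed of a bare function, so that the lemma also covers [T] minus a finite-rank
    sum, which is not packed as a linear map. *)
Lemma le_opnorm (T : X -> Y) (c : R) x : (forall (a : R[i]) x, T (a *: x) = a *: T x) ->
  (opnorm T <= c%:E)%E -> rnorm (T x) <= c * rnorm x.
Proof.
move=> TZ Tc.
have [x0|x0] := eqVneq (rnorm x) 0.
  have T0 : T 0 = 0 by rewrite -[X in T X](scale0r (0 : X)) TZ scale0r.
  by rewrite (rnorm0_eq0 x0) T0 !rnorm0 mulr0.
have nx : 0 < rnorm x by rewrite lt_def x0 rnorm_ge0.
pose u := ((rnorm x)^-1)%:C *: x.
have u1 : rnorm u = 1 by rewrite /u rnorm_scale gtr0_norm ?invr_gt0// mulVf.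
have : ((rnorm (T u))%:E <= c%:E)%E.
  by apply: le_trans Tc; apply: ereal_sup_ubound; exists u => //=; rewrite u1.
rewrite lee_fin /u TZ rnormZ rnorm_normc normc_real gtr0_norm ?invr_gt0//.
by rewrite ler_pdivrMl// mulrC.
Qed.

Lemma opnorm_fineK (T : X -> Y) : (opnorm T < +oo)%E -> (fine (opnorm T))%:E = opnorm T.
Proof. by move=> Too; rewrite fineK// ge0_fin_numE// opnorm_ge0. Qed.

End opnorm.

Lemma cseries_cvg (u : nat -> C) (M : R) : (forall N, \sum_(n < N) normc (u n) <= M) ->
  exists l : C, (fun N => \sum_(n < N) u n : C) @ \oo --> l.
Proof.
move=> uM.
have S (f : R[i] -> R) : (forall z, `|f z| <= normc z) ->
    cvgn (fun N => \sum_(n < N) f (u n)).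
  move=> fz.
  have -> : (fun N => \sum_(n < N) f (u n)) = series (fun n => f (u n)).
    by apply/funext => N; rewrite /series /= big_mkord.
  apply: normed_cvg; apply: nondecreasing_is_cvgn.
    by apply: nondecreasing_series => n _ _; exact: normr_ge0.
  exists M => _ [N _ <-].
  change (\sum_(0 <= k < N) `|f (u k)| <= M).
  rewrite big_mkord (le_trans _ (uM N))//.
  by apply: ler_sum => n _; exact: fz.
have /cvg_ex[a ca] := S _ (@normc_Re R).
have /cvg_ex[b cb] := S _ (@normc_Im R).
exists (a +i* b); apply/cvg_ReIm; split => /=.
  rewrite (_ : (fun x => _) = (fun N => \sum_(n < N) complex.Re (u n)))//.
  apply/funext => N; elim/big_ind2 : _ => [//|x ? y ? <- <-|//]; exact: ReD.
rewrite (_ : (fun x => _) = (fun N => \sum_(n < N) complex.Im (u n)))//.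
apply/funext => N; elim/big_ind2 : _ => [//|x ? y ? <- <-|//]; exact: ImD.
Qed.

Lemma cvgc_unique (u : nat -> C) (l l' : C) : u @ \oo --> l -> u @ \oo --> l' -> l = l'.
Proof. exact: (@cvg_unique _ (@norm_hausdorff _ _)). Qed.

Lemma cvgc_le (u : nat -> C) (l : C) (M : R) : u @ \oo --> l ->
  (\forall n \near \oo, normc (u n) <= M) -> normc l <= M.
Proof.
move=> /cvgc_lt ul uM; apply/ler_addgt0Pr => e e0.
near \oo => n.
have H1 : normc (u n) <= M by near: n.
have H2 : normc (l - u n) < e by near: n; exact: ul.
by have := ler_normcB l (u n); lra.
Unshelve. all: by end_near. Qed.

End bounded_operators.

(** * Nuclear and absolutely summing operators *)

Section summing.
Context {R : realType}.
Local Notation C := (R[i]^o).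

Section gliding_hump.
Variables (X : normedModType R[i]) (x : nat -> X).

Let p N (phi : X -> C) : R := \sum_(n < N) rnorm (phi (x n)).
Let q (N : nat) : R := \sum_(n < N) rnorm (x n).

Let q_ge0 N : 0 <= q N. Proof. by apply: sumr_ge0 => n _; exact: rnorm_ge0. Qed.

Let q_le N N' : (N <= N')%N -> q N <= q N'.
Proof.
move=> NN'; rewrite /q -(subnKC NN') big_split_ord /= lerDl.
by apply: sumr_ge0 => n _; exact: rnorm_ge0.
Qed.

Let p_le phi N N' : (N <= N')%N -> p N phi <= p N' phi.
Proof.
move=> NN'; rewrite /p -(subnKC NN') big_split_ord /= lerDl.
by apply: sumr_ge0 => n _; exact: rnorm_ge0.
Qed.

Let p_bound phi N c : (forall y, rnorm (phi y) <= c * rnorm y) -> p N phi <= c * q N.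
Proof. by move=> H; rewrite /p /q mulr_sumr; apply: ler_sum. Qed.

(* Uniform boundedness by a gliding hump: otherwise there are small functionals
   [phi_j] of rapidly increasing humps, and their sum violates the hypothesis. *)
Lemma weakly_summable_bound :
  (forall (phi : {linear X -> C}) c, (forall y, rnorm (phi y) <= c * rnorm y) ->
    exists M, forall N, p N phi <= M) ->
  exists K, forall (phi : {linear X -> C}) c, 0 <= c ->
    (forall y, rnorm (phi y) <= c * rnorm y) -> forall N, p N phi <= K * c.
Proof.
move=> H; apply: contrapT => nK.
have hump (eta B : R) k : 0 < eta -> 0 < B -> exists (psi : {linear X -> C}) k',
    [/\ forall y, rnorm (psi y) <= eta * rnorm y, (k <= k')%N & B <= p k' psi].
  move=> eta0 B0; apply: contrapT => nh; apply: nK.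
  (* Were there no such hump, rescaling each functional to norm at most [eta] would make [B / eta] a
     uniform bound. *)
  exists (B / eta) => phi c c0 phic N.
  rewrite leNgt; apply/negP => NB.
  have [c00|c00] := eqVneq c 0.
    suff : p N phi <= 0 by move: NB; rewrite c00 mulr0; lra.
    rewrite (le_trans (p_bound N phic))// c00 mul0r//.
  have cp : 0 < c by rewrite lt_def c00.
  apply: nh; exists ((eta / c)%:C \*: phi), (maxn k N); split.
  - move=> y; rewrite /= rnorm_scale ger0_norm ?divr_ge0 ?(ltW eta0)//.
    by rewrite mulrAC ler_pdivrMr// mulrAC -mulrA ler_wpM2l// ltW.
  - exact: leq_maxl.
  - apply: (@le_trans _ _ (p N ((eta / c)%:C \*: phi))); last first.
      by apply: p_le; exact: leq_maxr.
    rewrite /p; under eq_bigr do rewrite /= rnorm_scale ger0_norm ?divr_ge0 ?(ltW eta0)//.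
    rewrite -mulr_sumr -/(p N phi) mulrAC ler_pdivlMr// mulrC.
    by rewrite mulrC -ler_pdivrMl// mulrA ltW// [_^-1 * _]mulrC.
pose h j : R := 2^-1 ^+ j.
have h0 j : 0 < h j by rewrite exprn_gt0// invr_gt0.
have hS j : h j = h j.+1 + h j.+1 by rewrite /h exprS; lra.
(* The state holds the stage [j], the number [k] of vectors used so far and a bound [Q] for the
   total of the earlier functionals. The size [h j.+1 / (1 + q k)] makes the new functional
   negligible on those vectors; the height [j + 1 + |Q|] outweighs the earlier ones by [j + 1]. *)
have step (s : nat * (nat * R)) : exists t : ({linear X -> C} * (nat * R)),
    [/\ forall y, rnorm (t.1 y) <= h s.1.+1 / (1 + q s.2.1) * rnorm y,
        (s.2.1 <= t.2.1)%N,
        s.1%:R + 1 + `|s.2.2| <= p t.2.1 t.1 &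
        forall N, p N t.1 <= t.2.2].
  case: s => j [k Q] /=.
  have e0 : 0 < h j.+1 / (1 + q k) by rewrite divr_gt0// ltr_pwDl.
  have B0 : 0 < j%:R + 1 + `|Q| by rewrite ltr_pwDl// ltr_wpDl.
  have [psi [k' [H1 H2 H3]]] := hump _ _ k e0 B0.
  by have [M HM] := H psi _ H1; exists (psi, (k', M)).
move/choice : step => [f fP].
pose s := fix s j : nat * R := if j is i.+1 then
  let t := f (i, s i) in (t.2.1, (s i).2 + t.2.2) else (0%N, 0).
pose phi j := (f (j, s j)).1.
pose k j := (s j).1.
have kS j : k j.+1 = (f (j, s j)).2.1 by [].
have kle i j : (i <= j)%N -> (k i <= k j)%N.
  elim: j => [|j IH]; first by rewrite leqn0 => /eqP->.
  rewrite leq_eqVlt => /orP[/eqP->//|/IH/leq_trans]; apply.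
  by have [_ + _ _] := fP (j, s j).
have phib j y : rnorm (phi j y) <= h j.+1 / (1 + q (k j)) * rnorm y.
  by have [+ _ _ _] := fP (j, s j).
have phib1 j y : rnorm (phi j y) <= h j.+1 * rnorm y.
  rewrite (le_trans (phib j y))// ler_wpM2r ?rnorm_ge0//.
  by rewrite ler_pdivrMr ?ltr_pwDl// ler_peMr ?(ltW (h0 _))// lerDl.
have sumh m j : \sum_(i < m) h (j + i).+1 <= h j.
  suff : \sum_(i < m) h (j + i).+1 <= h j - h (j + m)%N by have := h0 (j + m)%N; lra.
  elim: m => [|m IH]; first by rewrite big_ord0 addn0 subrr.
  by rewrite big_ord_recr /= addnS; have := hS (j + m)%N; lra.
have /choice[L LP] (y : X) : exists l : C,
    (fun N => \sum_(n < N) phi n y : C) @ \oo --> l.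
  apply: (@cseries_cvg R (fun n => phi n y) (rnorm y)) => N.
  apply: (@le_trans _ _ (\sum_(n < N) h (0 + n).+1 * rnorm y)).
    by apply: ler_sum => n _; exact: phib1.
  rewrite -mulr_suml ler_piMl ?rnorm_ge0// (le_trans (sumh _ _))//.
have Ll : linear L.
  move=> a u v; apply: cvgc_unique (LP _) _.
  have -> : (fun N => \sum_(n < N) phi n (a *: u + v) : C) =
      (fun N => (a *: \sum_(n < N) phi n u : C) + \sum_(n < N) phi n v).
    apply/funext => N; rewrite scaler_sumr -big_split; apply: eq_bigr => n _ /=.
    by rewrite linearP.
  by apply: cvgD; [apply: cvgZr; exact: LP|exact: LP].
pose lL := GRing.isLinear.Build _ _ _ _ L Ll.
pose LL : {linear X -> C} := HB.pack L lL.
have Lb y : rnorm (LL y) <= 1 * rnorm y.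
  apply: cvgc_le (LP y) _; apply: nearW => N.
  apply: le_trans (normc_sum _ _ _) _.
  apply: (@le_trans _ _ (\sum_(n < N) h (0 + n).+1 * rnorm y)).
    by apply: ler_sum => n _; exact: phib1.
  rewrite -mulr_suml ler_wpM2r ?rnorm_ge0// (le_trans (sumh _ _))//.
have [M HM] := H LL 1 Lb.
(* Hump [j] gives [j + 1 + |Q|], the earlier functionals take away at most [|Q|] and the later ones
   at most 1. *)
have key j : j%:R <= p (k j.+1) LL.
  have Qj : forall N, \sum_(i < j) p N (phi i) <= `|(s j).2|.
    move=> N; apply: le_trans (ler_norm _).
    elim: (j) => [|i IH]; first by rewrite big_ord0.
    rewrite big_ord_recr /= lerD//.
    by have [_ _ _] := fP (i, s i).
  have pj : j%:R + 1 + `|(s j).2| <= p (k j.+1) (phi j).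
    by have [_ _ + _] := fP (j, s j).
  have main m : j%:R <= p (k j.+1) (fun y => \sum_(i < j.+1 + m) phi i y).
    have T (y : X) : rnorm (phi j y) - \sum_(i < j) rnorm (phi i y)
        - \sum_(i < m) rnorm (phi (j.+1 + i)%N y) <=
        rnorm (\sum_(i < j.+1 + m) phi i y).
      pose a : C := \sum_(i < j) phi i y; pose b : C := phi j y.
      pose c : C := \sum_(i < m) phi (j.+1 + i)%N y.
      have -> : \sum_(i < j.+1 + m) phi i y = a + b + c.
        by rewrite big_split_ord big_ord_recr.
      have H1 : rnorm a <= \sum_(i < j) rnorm (phi i y) by exact: rnorm_sum.
      have H2 : rnorm c <= \sum_(i < m) rnorm (phi (j.+1 + i)%N y) by exact: rnorm_sum.
      have H3 : rnorm b <= rnorm (a + b + c) + rnorm a + rnorm c.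
        have {1}-> : b = (a + b + c) - a - c by rewrite -!addrA [b + _]addrC; ring.
        apply: le_trans (rnormD _ _) _; rewrite rnormN lerD2r.
        by apply: le_trans (rnormD _ _) _; rewrite rnormN.
      lra.
    have tail : \sum_(i < m) p (k j.+1) (phi (j.+1 + i)%N) <= 1.
      apply: (@le_trans _ _ (\sum_(i < m) h (j.+1 + i).+1)).
        apply: ler_sum => i _; apply: le_trans (p_bound _ (phib _)) _.
        rewrite -mulrA ler_piMr// ?(ltW (h0 _))// mulrC ler_pdivrMr ?ltr_pwDl// mul1r.
        have : q (k j.+1) <= q (k (j.+1 + i)%N) by apply: q_le; apply: kle; exact: leq_addr.
        lra.
      by apply: le_trans (sumh _ _) _; rewrite exprn_ile1 ?invr_ge0 ?invf_le1 ?ler1n.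
    have S : p (k j.+1) (phi j) - \sum_(i < j) p (k j.+1) (phi i)
        - \sum_(i < m) p (k j.+1) (phi (j.+1 + i)%N) <=
        p (k j.+1) (fun y => \sum_(i < j.+1 + m) phi i y).
      rewrite /p [X in _ - X - _]exchange_big [X in _ - _ - X]exchange_big /= -!sumrB.
      by apply: ler_sum => n _; exact: T.
    have := Qj (k j.+1); lra.
  (* With finitely many vectors fixed, pointwise convergence of the functionals is enough to pass to
     the limit. *)
  have cv : (fun N => p (k j.+1) (fun y => \sum_(i < N) phi i y)) @ \oo --> p (k j.+1) LL.
    rewrite /p; elim: (k j.+1) => [|n IH].
      under [X in X @ _ --> _]funext do rewrite big_ord0.
      by rewrite big_ord0; exact: cvg_cst.
    under [X in X @ _ --> _]funext do rewrite big_ord_recr.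
    rewrite big_ord_recr; apply: cvgD; first exact: IH.
    apply: (cvg_comp _ (fun z : C => rnorm z) (LP (x n))).
    exact: rnorm_continuous.
  rewrite -(cvg_lim _ cv)//; apply: limr_ge.
    by apply/cvg_ex; eexists; exact: cv.
  exists j.+1 => // N /= jN; rewrite -(subnKC jN); exact: main.
have [j jM] : exists j : nat, M < j%:R.
  by exists (Num.truncn `|M|).+1; rewrite (le_lt_trans (ler_norm M))// truncnS_gt.
by have := key j; have := HM (k j.+1); lra.
Qed.

End gliding_hump.

Lemma nuclear_absolutely_summing (X Y : normedModType R[i]) (T : {linear X -> Y}) :
  (opnorm T < +oo)%E -> nuclear T -> absolutely_summing T.
Proof.
move=> Too [xs [y [xs_sum [M yM] D0]]]; split => // x wx.
have xsoo n : (opnorm (xs n) < +oo)%E.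
  apply: le_lt_trans xs_sum.
  have := @nneseries_lim_ge _ (fun n => opnorm (xs n)) xpredT 0%N n.+1.
  move=> /(_ (fun n _ _ => opnorm_ge0 _)); apply: le_trans.
  rewrite big_mkord big_ord_recr /= leeDr// sume_ge0// => i _; exact: opnorm_ge0.
pose a n := fine (opnorm (xs n)).
have a0 n : 0 <= a n by rewrite fine_ge0// opnorm_ge0.
have aE n : (a n)%:E = opnorm (xs n) by exact: opnorm_fineK.
have xsa n u : rnorm (xs n u) <= a n * rnorm u.
  by apply: le_opnorm; [move=> k v; rewrite linearZ|rewrite aE].
have [A HA] : exists A : R, forall N, \sum_(n < N) a n <= A.
  apply/(nneseries_ltyP a0); rewrite (eq_eseriesr (g := fun n => opnorm (xs n)))//.
have [K HK] : exists K, forall (phi : {linear X -> C}) c, 0 <= c ->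
    (forall y, rnorm (phi y) <= c * rnorm y) ->
    forall N, \sum_(n < N) rnorm (phi (x n)) <= K * c.
  apply: weakly_summable_bound => phi c phic.
  apply/(nneseries_ltyP (fun n => rnorm_ge0 (phi (x n)))); apply: wx.
  apply: (@le_lt_trans _ _ `|c|%:E); last exact: ltry.
  apply: opnorm_le => // u; rewrite (le_trans (phic u))// ler_wpM2r ?rnorm_ge0//.
  exact: ler_norm.
have M0 : 0 <= M by exact: le_trans (rnorm_ge0 _) (yM 0%N).
apply/(nneseries_ltyP (fun n => rnorm_ge0 (T (x n)))).
exists (M * (`|K| * A)) => J.
pose q := \sum_(k < J) rnorm (x k).
have q0 : 0 <= q by apply: sumr_ge0 => k _; exact: rnorm_ge0.
apply/ler_addgt0Pr => e e0.
(* With this accuracy the operator-norm remainder contributes at most [e] over all [J] vectors. The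
   truncation [N] depends on [J] and [e], but the bound [M * (|K| * A)] does not. *)
have e1 : 0 < e / (1 + q) by rewrite divr_gt0// ltr_pwDl.
have [N DN] : exists N, (opnorm (fun x => T x - \sum_(n < N) xs n x *: y n)%R <=
    (e / (1 + q))%R%:E)%E.
  have /fine_cvgP[[N1 _ fN] /cvgrPdist_lt/(_ _ e1)[N2 _ dN]] := D0.
  exists (maxn N1 N2); have := dN _ (leq_maxr N1 N2); have := fN _ (leq_maxl N1 N2) => /= F.
  rewrite sub0r normrN => H; rewrite -(fineK F) lee_fin ltW//.
  by apply: le_lt_trans H; exact: ler_norm.
have TxN u : rnorm (T u) <= e / (1 + q) * rnorm u + \sum_(n < N) rnorm (xs n u) * M.
  pose S := \sum_(n < N) xs n u *: y n.
  rewrite -[T u](subrK S) (le_trans (rnormD _ _))// lerD//.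
    apply: (@le_opnorm _ _ _ (fun x => T x - \sum_(n < N) xs n x *: y n)) => // k v.
    rewrite linearZ scalerBr scaler_sumr; congr (_ - _).
    by apply: eq_bigr => n _; rewrite linearZ /= scalerA.
  apply: le_trans (rnorm_sum _ _ _) _; apply: ler_sum => n _.
  by rewrite rnormZ ler_wpM2l ?rnorm_ge0.
apply: (@le_trans _ _ (\sum_(k < J) (e / (1 + q) * rnorm (x k) +
    \sum_(n < N) rnorm (xs n (x k)) * M))).
  by apply: ler_sum => k _; exact: TxN.
rewrite big_split /= -mulr_sumr -/q addrC lerD//; last first.
  by rewrite mulrAC ler_pdivrMr ?ltr_pwDl// ler_pM2l// lerDr.
rewrite exchange_big /=; under eq_bigr do rewrite -mulr_suml.
rewrite -mulr_suml mulrC ler_wpM2l//.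
apply: (@le_trans _ _ (\sum_(n < N) `|K| * a n)).
  apply: ler_sum => n _; rewrite (le_trans (HK (xs n) _ (a0 n) (xsa n) J))//.
  by rewrite ler_wpM2r// ler_norm.
by rewrite -mulr_sumr ler_wpM2l.
Qed.

End summing.

(** * Bounds for the exponential and for Poisson probabilities *)

Section exponential_estimates.
Context {R : realType}.

Lemma sum_exp_coeff_le (s : R) N : 0 <= s -> \sum_(n < N) s ^+ n / n`!%:R <= expR s.
Proof.
move=> s0; have := is_cvg_series_exp_coeff s => cv.
rewrite /expR; apply: (@le_trans _ _ (series (exp_coeff s) N)).
  by rewrite /series /= big_mkord.
apply: nondecreasing_cvgn_le => //; apply: nondecreasing_series => n _ _.
exact: exp_coeff_ge0.
Qed.

Lemma expn_fact_le_expR (s : R) n : 0 <= s -> s ^+ n / n`!%:R <= expR s.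
Proof.
move=> s0; apply: le_trans (sum_exp_coeff_le n.+1 s0).
rewrite big_ord_recr /= lerDr; apply: sumr_ge0 => i _.
by apply: divr_ge0; [exact: exprn_ge0|].
Qed.

(* [(1 + y) e^-y - (1 - y) e^y] vanishes at [0] and has derivative [y (e^y - e^-y)]. *)
Lemma expR2_le (y : R) : 0 <= y -> (1 - y) * expR (2 * y) <= 1 + y.
Proof.
move=> y0.
pose k (y : R) := (1 + y) * expR (- y) - (1 - y) * expR y.
have dk (x : R) : is_derive x 1 k (x * (expR x - expR (- x))).
  by apply: is_derive_eq; rewrite /GRing.scale /=; ring.
have [|c cy kE] := @MVT_segment _ k (fun x => x * (expR x - expR (- x))) 0 y y0.
  apply: continuous_subspaceT => x.
  by apply/differentiable_continuous/derivable1_diffP; have [] := dk x.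
have : 0 <= k y.
  have <- : k y - k 0 = k y by rewrite /k oppr0 expR0; ring.
  rewrite kE subr0; apply: mulr_ge0 => //; move: cy; rewrite in_itv /= => /andP[c0 _].
  by rewrite mulr_ge0// subr_ge0 ler_expR; lra.
rewrite /k subr_ge0 => H.
have := ler_wpM2r (expR_ge0 y) H.
rewrite -!mulrA -!expRD addNr expR0 mulr1.
by have -> : y + y = 2 * y by ring.
Qed.

(** A weak form of Stirling's formula: [p m ^ 2 * m] is nondecreasing for [m >= 1] and equals
    [expR (-2)] at [m = 1]. The denominator with [2 m + 1] covers [m = 0] and is the weight of
    statement (iv) at index [2 m]. *)
Lemma poisson_mode_ge (m : nat) :
  expR (-1) / Num.sqrt (2 * m).+1%:R <= m%:R ^+ m / m`!%:R * expR (- m%:R) :> R.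
Proof.
pose p m : R := m%:R ^+ m / m`!%:R * expR (- m%:R).
have p0 k : 0 <= p k by rewrite mulr_ge0 ?expR_ge0// divr_ge0// exprn_ge0.
have pS k : expR (-2) <= p k.+1 ^+ 2 * k.+1%:R.
  elim: k => [|k IH].
    by rewrite /p expr1 (_ : 1`! = 1%N)// divr1 mulr1 mul1r -expRM_natl mulrN1.
  apply: le_trans IH _.
  pose z : R := k.+1%:R.
  have z0 : 0 < z by rewrite ltr0n.
  have zS : k.+2%:R = z + 1 :> R by rewrite natr1.
  have fS : (k.+2)`!%:R = (z + 1) * (k.+1)`!%:R :> R by rewrite factS natrM zS.
  have f0 : (k.+1)`!%:R != 0 :> R by rewrite pnatr_eq0 -lt0n fact_gt0.
  have pE : p k.+2 = p k.+1 * ((z + 1) / z) ^+ k.+1 * expR (- 1).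
    rewrite /p fS zS -/z opprD expRD exprS expr_div_n; field.
    by rewrite f0 expf_neq0 ?gt_eqF// addr_gt0.
  (* For [y = 1 / (2 z + 1)] the quotient [(1 + y) / (1 - y)] is [(z + 1) / z], and the power
     [2 z + 1] of [expR (2 y)] is [expR 2]. *)
  have y0 : 0 <= (2 * z + 1)^-1 by rewrite invr_ge0; lra.
  have E : expR 2 <= ((z + 1) / z) ^+ (2 * k.+1).+1.
    have H := expR2_le y0.
    have -> : 2 = (2 * (2 * z + 1)^-1) * (2 * k.+1).+1%:R :> R.
      rewrite (_ : (2 * k.+1).+1%:R = 2 * z + 1); last by rewrite -[LHS]natr1 natrM.
      by field; lra.
    rewrite expRM_natr lerXn2r ?nnegrE ?expR_ge0//.
      by rewrite divr_ge0 ?addr_ge0 ?ler0n.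
    have H1 : 0 < 1 - (2 * z + 1)^-1.
      by rewrite subr_gt0 invf_lt1; lra.
    rewrite -(ler_pM2l H1) (le_trans H)// le_eqVlt; apply/orP; left; apply/eqP.
    by field; lra.
  have -> : p k.+2 ^+ 2 * k.+2%:R =
      p k.+1 ^+ 2 * z * (((z + 1) / z) ^+ (2 * k.+1).+1 * expR (-2)).
    have -> : expR (-2) = expR (-1) ^+ 2 :> R by rewrite -expRM_natl mulrN1.
    have -> : ((z + 1) / z) ^+ (2 * k.+1).+1 = (((z + 1) / z) ^+ k.+1) ^+ 2 * ((z + 1) / z).
      by rewrite exprSr mulnC exprM.
    by rewrite pE zS; set u := _ ^+ k.+1; field; lra.
  rewrite ler_peMr ?mulr_ge0 ?sqr_ge0 ?ler0n//.
  by rewrite expRN ler_pdivlMr ?expR_gt0// mul1r.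
rewrite -/(p m) ler_pdivrMr ?sqrtr_gt0 ?ltr0n//.
(* The monotone quantity vanishes at [m = 0]; there the convention [0 ^ 0 = 1] gives [p 0 = 1]. *)
case: m => [|m].
  have -> : p 0%N * Num.sqrt (2 * 0).+1%:R = 1.
    by rewrite /p expr0 fact0 divr1 oppr0 expR0 muln0 sqrtr1 !mulr1.
  by rewrite expR_le1 lerN10.
have s : 0 <= p m.+1 * Num.sqrt (2 * m.+1).+1%:R by rewrite mulr_ge0// sqrtr_ge0.
rewrite -(@ler_pXn2r _ 2) ?nnegrE ?expR_ge0// exprMn sqr_sqrtr// -expRM_natl mulrN1.
apply: le_trans (_ : p m.+1 ^+ 2 * m.+1%:R <= _).
  by apply: le_trans (pS m); rewrite ler_expR; lra.
by rewrite ler_wpM2l ?sqr_ge0// ler_nat mul2n -addnn -addnS leq_addr.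
Qed.

End exponential_estimates.

(** * The moments of an absolutely summing Hausdorff operator *)

Section monomials.
Context {R : realType} (alpha : R).
Hypothesis alpha0 : 0 < alpha.
Local Notation C := (R[i]^o).

(** With [s = alpha / 2 * |z|^2], the bound [s^(n+1) e^(-s) <= (n+1)!] leaves a spare factor
    [1 / s], hence decay at least like [1 / |z|]. *)
Lemma monomial_fock_infty (c : C) n : is_fock_infty alpha (fun z => c * z ^+ n).
Proof.
split.
  move=> z; apply: (@derivable_cM _ (fun=> c) (fun z => z ^+ n)); first exact: derivable_cst.
  exact: derivable_cX.
pose K := normc c * (2 / alpha) ^+ n * n.+1`!%:R * (2 / alpha).
have a0 : 0 <= 2 / alpha by rewrite divr_ge0// ltW.
have K0 : 0 <= K by rewrite /K !mulr_ge0 ?invr_ge0 ?normc_ge0 ?exprn_ge0 ?ler0n ?(ltW alpha0).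
have bound z : 1 <= normc z -> fock_weight alpha (fun z => c * z ^+ n) z <= K / normc z.
  move=> z1; have z0 : 0 < normc z by exact: lt_le_trans z1.
  rewrite /fock_weight /gauss !rnorm_normc normcM normcX.
  set r := normc z in z1 z0 *.
  pose s := alpha / 2 * r ^+ 2.
  have a2 : 0 < alpha / 2 by rewrite divr_gt0.
  have s0 : 0 < s by rewrite mulr_gt0// exprn_gt0.
  have sE : r ^+ 2 = 2 / alpha * s by rewrite /s; field; rewrite gt_eqF.
  have H : s ^+ n.+1 * expR (- s) <= n.+1`!%:R.
    rewrite expRN ler_pdivrMr ?expR_gt0// mulrC -ler_pdivrMr ?ltr0n ?fact_gt0//.
    exact/expn_fact_le_expR/ltW.
  rewrite mulNr -/s.
  have rn : r ^+ n <= (2 / alpha) ^+ n * s ^+ n.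
    by rewrite -exprMn -sE -exprM ler_weXn2l// leq_pmull.
  apply: (@le_trans _ _ (normc c * ((2 / alpha) ^+ n * s ^+ n) * expR (- s))).
    by rewrite ler_wpM2r ?expR_ge0// ler_wpM2l ?normc_ge0.
  have E1 : s ^+ n * expR (- s) <= n.+1`!%:R / s.
    by rewrite ler_pdivlMr// mulrAC -exprSr.
  have -> : normc c * ((2 / alpha) ^+ n * s ^+ n) * expR (- s) =
      normc c * (2 / alpha) ^+ n * (s ^+ n * expR (- s)) by ring.
  apply: (@le_trans _ _ (normc c * (2 / alpha) ^+ n * (n.+1`!%:R / s))).
    by rewrite ler_wpM2l// mulr_ge0 ?normc_ge0 ?exprn_ge0.
  have -> : K / r = normc c * (2 / alpha) ^+ n * (n.+1`!%:R * (2 / alpha / r)).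
    by rewrite /K; ring.
  rewrite ler_wpM2l ?mulr_ge0 ?normc_ge0 ?exprn_ge0//.
  rewrite ler_wpM2l// /s invfM invf_div ler_wpM2l//.
  by rewrite lef_pV2 ?posrE ?exprn_gt0// expr2 ler_pMr.
apply/cvgrPdist_lt => e e0.
exists (Num.max 1 (K / e)) => // z /=; rewrite gt_max rnorm_normc => /andP[z1 ze].
rewrite sub0r normrN ger0_norm ?fock_weight_ge0//.
rewrite (le_lt_trans (bound z (ltW z1)))// ltr_pdivrMr ?(lt_trans ltr01)//.
by rewrite -ltr_pdivrMl// mulrC.
Qed.

Definition monomial (c : C) n : fock_infty alpha :=
  FockInfty (introT (fock_infty_predP _ _) (monomial_fock_infty c n)).

Lemma rnorm_fock (f : fock_infty alpha) : rnorm f = fock_norm f.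
Proof. by []. Qed.

Lemma fock_sumE (I : Type) (r : seq I) (P : pred I) (F : I -> fock_infty alpha) (z : C) :
  (\sum_(i <- r | P i) F i) z = \sum_(i <- r | P i) F i z.
Proof. by elim/big_rec2 : _ => // i y1 y2 _ <-. Qed.

Lemma fock_scaleE (a : C) (f : fock_infty alpha) (z : C) : (a *: f) z = a * f z.
Proof. by []. Qed.

End monomials.

Section exponential_monomials.
Context {R : realType} (alpha : R).
Hypothesis alpha0 : 0 < alpha.
Local Notation C := (R[i]^o).

(* The weighted moduli of these monomials at [z] are the Poisson probabilities of
   parameter [alpha |z|^2 / 2]; in particular they sum to [1]. *)
Definition exp_monomial m : fock_infty alpha :=
  monomial alpha0 ((alpha / 2) ^+ m / m`!%:R)%:C (2 * m).

Let exp_monomialE m (z : C) : rnorm (exp_monomial m z) =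
  (alpha / 2 * rnorm z ^+ 2) ^+ m / m`!%:R.
Proof.
rewrite /= !rnorm_normc normcM normcX normc_real ger0_norm; last first.
  by rewrite divr_ge0// exprn_ge0// divr_ge0// ltW.
by rewrite exprM [in RHS]exprMn mulrAC.
Qed.

Lemma exp_monomial_sum_le (eps : nat -> C) N : (forall m, normc (eps m) <= 1) ->
  rnorm (\sum_(m < N) eps m *: exp_monomial m) <= 1.
Proof.
move=> eps1; rewrite rnorm_fock; apply: fock_norm_le => z.
rewrite /fock_weight /gauss fock_sumE.
set s := alpha / 2 * rnorm z ^+ 2.
have s0 : 0 <= s by rewrite mulr_ge0 ?sqr_ge0// divr_ge0// ltW.
rewrite mulNr -/s expRN ler_pdivrMr ?expR_gt0// mul1r.
apply: le_trans (sum_exp_coeff_le N s0).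
apply: le_trans (rnorm_sum _ _ _) _; apply: ler_sum => m _.
rewrite fock_scaleE rnorm_normc normcM -[X in _ * X]rnorm_normc exp_monomialE -/s.
by rewrite ler_piMl// divr_ge0// exprn_ge0.
Qed.

(** The phases [eps] turn the sum of moduli into the value of [phi] at a single vector of the unit
    ball. *)
Lemma exp_monomial_weakly_summable (phi : {linear fock_infty alpha -> C}) :
  (opnorm phi < +oo)%E ->
  (\sum_(0 <= n <oo) (rnorm (phi (exp_monomial n)))%:E < +oo)%E.
Proof.
move=> phioo; apply/(nneseries_ltyP (fun n => rnorm_ge0 (phi (exp_monomial n)))).
exists (fine (opnorm phi)) => N.
pose w m := phi (exp_monomial m).
pose eps m : C := if w m == 0 then 0 else (normc (w m))%:C / w m.
have epsE m : eps m * w m = (normc (w m))%:C.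
  by rewrite /eps; have [->|w0] := eqVneq (w m) 0; rewrite ?mul0r ?normc0// divfK.
have eps1 m : normc (eps m) <= 1.
  rewrite /eps; have [_|w0] := eqVneq (w m) 0; first by rewrite normc0.
  rewrite normcM normcV normc_real ger0_norm ?normc_ge0//.
  by rewrite divff// normc_eq0.
have -> : \sum_(n < N) rnorm (phi (exp_monomial n)) =
    rnorm (phi (\sum_(m < N) eps m *: exp_monomial m)).
  rewrite linear_sum; under [in RHS]eq_bigr do rewrite linearZ /= -/(w _).
  under [in RHS]eq_bigr do rewrite [_ *: _]epsE.
  rewrite rnorm_normc -rmorph_sum normc_real ger0_norm//.
  by apply: sumr_ge0 => m _; exact: normc_ge0.
rewrite -lee_fin opnorm_fineK//; apply: ereal_sup_ubound.
by exists (\sum_(m < N) eps m *: exp_monomial m) => //=; exact: exp_monomial_sum_le.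
Qed.

End exponential_monomials.

Section moments.
Context {R : realType} (alpha : R) (mu : {measure set (measurableTypeR R) -> \bar R}).
Hypothesis alpha0 : 0 < alpha.
Local Notation C := (R[i]^o).
Variable T : {linear fock_infty alpha -> fock_infty alpha}.
Hypothesis hT : is_hausdorff_operator mu T.

Let mD : measurable (`]0, +oo[%classic : set (measurableTypeR R)).
Proof. exact: measurable_itv. Qed.

Lemma invXn_gt0 (t : R) n : t \in `]0, +oo[ -> 0 < t ^- n.
Proof. by rewrite in_itv /= andbT => t0; rewrite invr_gt0 exprn_gt0. Qed.

Lemma measurable_invXn n :
  measurable_fun (`]0, +oo[%classic : set (measurableTypeR R)) (fun t => t ^- n : R).
Proof.
apply: open_continuous_measurable_fun.
  exact: interval_open.
move=> t; rewrite inE /= in_itv /= andbT => t0.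
have tn : t ^+ n != 0; first by rewrite expf_neq0// gt_eqF.
apply: (cvgV tn); exact: exprn_continuous.
Qed.

Lemma hausdorff_moment_ge0 n : (0 <= hausdorff_moment mu n)%E.
Proof. by apply: integral_ge0 => t /invXn_gt0 H; rewrite lee_fin ltW. Qed.

(* The radius at which [exp_monomial m] attains its norm. *)
Let r m : R := Num.sqrt (2 * m%:R / alpha).
Let b m : R := m%:R ^+ m / m`!%:R.

Let r2 m : r m ^+ 2 = 2 * m%:R / alpha.
Proof. by rewrite sqr_sqrtr// divr_ge0 ?mulr_ge0 ?ler0n// ltW. Qed.

Let b_gt0 m : 0 < b m.
Proof.
by rewrite divr_gt0 ?ltr0n ?fact_gt0//; case: m => [|m]; rewrite ?expr0// exprn_gt0.
Qed.

(** At the real point [r m] the product [(alpha / 2)^m * (r m)^(2 m)] is [m^m]: [alpha] disappears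
    and the integrand is real. *)
Let integrandE m (t : R) :
  hausdorff_integrand (exp_monomial alpha0 m) (r m)%:C t = (b m * t ^- (2 * m).+1)%:C.
Proof.
rewrite /hausdorff_integrand /= -fmorphV -rmorphM -rmorphXn -rmorphM -rmorphM; congr (_%:C).
have -> : (r m / t) ^+ (2 * m) = (2 * m%:R / alpha) ^+ m / t ^+ (2 * m).
  by rewrite exprMn exprM r2 exprVn.
have -> : (2 * m%:R / alpha) ^+ m = (alpha / 2) ^- m * m%:R ^+ m.
  by rewrite -exprVn -exprMn; congr (_ ^+ _); field; rewrite gt_eqF.
have : (alpha / 2) ^+ m != 0 by rewrite expf_neq0// gt_eqF// divr_gt0.
rewrite /b exprS invfM; move: (t ^+ (2 * m)) ((alpha / 2) ^+ m) => u v v0.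
transitivity (v / v * (m%:R ^+ m / m`!%:R * (t^-1 / u))); first by ring.
by rewrite divff// mul1r.
Qed.

(** Finiteness of this moment is contained in the well-definedness of the operator: the integrand of
    [exp_monomial m] at [r m] is a positive multiple of this power. *)
Lemma even_moment_integrable m :
  mu.-integrable `]0, +oo[ (fun t : R => (t ^- (2 * m).+1)%:E).
Proof.
have [[+ _] _] := hT.1 (exp_monomial alpha0 m) (r m)%:C.
move=> H; apply: eq_integrable (integrableZl mD (b m)^-1 H) => // t _; rewrite integrandE /= -EFinM; congr (_%:E).
by rewrite mulKf// gt_eqF.
Qed.

Lemma even_moment_fineK m :
  (fine (hausdorff_moment mu (2 * m)))%:E = hausdorff_moment mu (2 * m).
Proof. by rewrite fineK//; apply: integrable_fin_num => //; exact: even_moment_integrable. Qed.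

(** Evaluating the weight of the image at [r m], where the Gaussian is [expR (- m)], gives the
    moment times the largest Poisson probability. *)
Lemma even_moment_le m : fine (hausdorff_moment mu (2 * m)) / Num.sqrt (2 * m).+1%:R <=
  expR 1 * rnorm (T (exp_monomial alpha0 m)).
Proof.
have [_ TE] := hT.1 (exp_monomial alpha0 m) (r m)%:C.
have ReT : complex.Re (T (exp_monomial alpha0 m) (r m)%:C) =
    b m * fine (hausdorff_moment mu (2 * m)).
  rewrite TE /hausdorff /=.
  under eq_Rintegral do rewrite integrandE /=.
  by rewrite RintegralZl//; exact: even_moment_integrable.
have := fock_weight_le_norm (T (exp_monomial alpha0 m)) (r m)%:C.
rewrite /fock_weight /gauss !rnorm_normc normc_real ger0_norm ?sqrtr_ge0// r2.
have -> : - (alpha / 2) * (2 * m%:R / alpha) = - m%:R by field; rewrite gt_eqF.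
move=> H.
have M0 : 0 <= fine (hausdorff_moment mu (2 * m)).
  by rewrite fine_ge0// hausdorff_moment_ge0.
have H1 : b m * fine (hausdorff_moment mu (2 * m)) * expR (- m%:R) <=
    rnorm (T (exp_monomial alpha0 m)).
  apply: le_trans H; rewrite ler_wpM2r ?expR_ge0//.
  by rewrite -ReT (le_trans (ler_norm _))// normc_Re.
rewrite -ler_pdivrMl ?expR_gt0// (le_trans _ H1)//.
rewrite [leRHS]mulrAC -expRN mulrCA mulrC ler_wpM2r//.
exact: poisson_mode_ge.
Qed.

(* Reduces the odd moments to the even ones, which are eigenvalues at [exp_monomial]. *)
Lemma hausdorff_momentS_le n :
  (hausdorff_moment mu n.+1 <= hausdorff_moment mu n + hausdorff_moment mu n.+2)%E.
Proof.
have mX k : measurable_fun (`]0, +oo[%classic : set (measurableTypeR R))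
    (fun t => (t ^- k : R)%:E).
  by apply/measurable_EFinP; exact: measurable_invXn.
have H1 k (t : R) : `]0, +oo[%classic t -> (0 <= (t ^- k)%:E)%E.
  by move=> /invXn_gt0 H; rewrite lee_fin ltW.
rewrite /hausdorff_moment -ge0_integralD//; try exact: H1; try exact: mX.
apply: ge0_le_integral => //. 
- exact: H1.
- by apply: emeasurable_funD; exact: mX.
- move=> t t0; rewrite -EFinD lee_fin.
  have u0 : 0 < t^-1 by have := @invXn_gt0 t 1 t0; rewrite expr1.
  rewrite -!exprVn; set u := t^-1 in u0 *.
  have un : 0 <= u ^+ n.+1 by rewrite exprn_ge0// ltW.
  have -> : u ^+ n.+2 = u ^+ n.+1 * u by rewrite exprSr.
  have -> : u ^+ n.+1 + u ^+ n.+3 = u ^+ n.+1 * (1 + u ^+ 2).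
    by rewrite mulrDr mulr1 -exprD addn2.
  by rewrite ler_wpM2l//; have := sqr_ge0 (u - 1); rewrite sqrrB expr1n mulr1; lra.
Qed.

Lemma absolutely_summing_moments : absolutely_summing T ->
  (\sum_(0 <= n <oo) hausdorff_moment mu n * ((Num.sqrt n.+1%:R)^-1)%R%:E < +oo)%E.
Proof.
move=> [_ /(_ _ (exp_monomial_weakly_summable alpha0))].
move=> /(nneseries_ltyP (fun m => rnorm_ge0 (T (exp_monomial alpha0 m))))[M HM].
pose a n := fine (hausdorff_moment mu n).
have a0 n : 0 <= a n by rewrite fine_ge0// hausdorff_moment_ge0.
have aE n : (a n)%:E = hausdorff_moment mu n.
  rewrite /a fineK// ge0_fin_numE ?hausdorff_moment_ge0//.
  have even m : (hausdorff_moment mu (2 * m) < +oo)%E by rewrite -even_moment_fineK ltry.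
  rewrite -(odd_double_half n) -mul2n; case: (odd n) => /=; last exact: even.
  rewrite add1n (le_lt_trans (hausdorff_momentS_le _))// lte_add_pinfty ?even//.
  by rewrite -[(_.+2)%N]add2n -mulnS even.
have aS n : a n.+1 <= a n + a n.+2.
  by rewrite -lee_fin EFinD !aE hausdorff_momentS_le.
pose u n := a n / Num.sqrt n.+1%:R.
have u0 n : 0 <= u n by rewrite divr_ge0// sqrtr_ge0.
rewrite (eq_eseriesr (g := fun n => (u n)%:E)); last first.
  by move=> n _; rewrite -aE -EFinM.
apply/(nneseries_ltyP u0).
(* The weight moves from index [2 m + 1] to [2 m + 2] at the cost of a factor 2, since
   [sqrt (c + 2) <= 2 * sqrt (c + 1)]. *)
have uS m : u (2 * m).+1 <= u (2 * m)%N + 2 * u (2 * m.+1)%N.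
  pose c : R := (2 * m).+1%:R.
  have c1 : 1 <= c by rewrite ler1n.
  have E1 : (2 * m).+2%:R = c + 1 :> R by rewrite natr1.
  have E2 : (2 * m.+1).+1%:R = c + 2 :> R by rewrite mulnS !addSn add0n -!natr1 -/c; ring.
  rewrite /u E1 E2 -/c.
  have s0 (x : R) : 1 <= x -> 0 < Num.sqrt x by move=> x1; rewrite sqrtr_gt0; lra.
  have s1 : (Num.sqrt (c + 1))^-1 <= (Num.sqrt c)^-1.
    by rewrite lef_pV2 ?posrE ?s0// ?ler_sqrt; lra.
  have s2 : (Num.sqrt (c + 1))^-1 <= 2 / Num.sqrt (c + 2).
    rewrite ler_pdivlMr ?s0//; [|lra]; rewrite ler_pdivrMl ?s0//; [|lra].
    rewrite -(@ler_pXn2r _ 2) ?nnegrE ?sqrtr_ge0 ?mulr_ge0 ?sqrtr_ge0//.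
    by rewrite exprMn !sqr_sqrtr; lra.
  apply: (@le_trans _ _ ((a (2 * m)%N + a (2 * m).+2) / Num.sqrt (c + 1))).
    by rewrite ler_wpM2r ?invr_ge0 ?sqrtr_ge0//; exact: aS.
  have -> : (2 * m.+1 = (2 * m).+2)%N by rewrite mulnS.
  rewrite mulrDl lerD ?ler_wpM2l//.
  by rewrite mulrCA ler_wpM2l.
have [M' HM'] : exists M', forall N, \sum_(m < N) u (2 * m)%N <= M'.
  exists (expR 1 * M) => N.
  apply: (@le_trans _ _ (\sum_(m < N) expR 1 * rnorm (T (exp_monomial alpha0 m)))).
    by apply: ler_sum => m _; exact: even_moment_le.
  by rewrite -mulr_sumr ler_pM2l ?expR_gt0.
(* Up to index [2 N], the even terms are counted once directly, once from [u (2 m)] and twice from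
   [u (2 m + 2)] through the odd ones. *)
exists (4 * M') => N.
apply: (@le_trans _ _ (\sum_(n < 2 * N) u n)).
  rewrite -(subnKC (leq_pmull N (ltn0Sn 1))) big_split_ord /= lerDl.
  by apply: sumr_ge0.
have -> : \sum_(n < 2 * N) u n = \sum_(m < N) (u (2 * m)%N + u (2 * m).+1).
  elim: N => [|N IH]; first by rewrite !big_ord0.
  by rewrite mulnS add2n !big_ord_recr /= IH addrA.
apply: (@le_trans _ _ (2 * \sum_(m < N) u (2 * m)%N + 2 * \sum_(m < N) u (2 * m.+1)%N)).
  rewrite !mulr_sumr -big_split; apply: ler_sum => m _ /=; have := uS m; lra.
have := HM' N; have := HM' N.+1.
rewrite big_ord_recl /=; under eq_bigr do rewrite /bump /= add1n.
by have := u0 (2 * 0)%N; lra.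
Qed.

End moments.

(** * Nuclearity of the Hausdorff operator *)

Section moment_series.
Context {R : realType} (mu : {measure set (measurableTypeR R) -> \bar R}).
Hypothesis mu_sum : (\sum_(0 <= n <oo) hausdorff_moment mu n < +oo)%E.

Let mD : measurable (`]0, +oo[%classic : set (measurableTypeR R)).
Proof. exact: measurable_itv. Qed.

Definition moment n : R := fine (hausdorff_moment mu n).

Lemma momentE n : (moment n)%:E = hausdorff_moment mu n.
Proof.
rewrite /moment fineK// ge0_fin_numE ?hausdorff_moment_ge0//.
apply: le_lt_trans mu_sum.
have := @nneseries_lim_ge _ (hausdorff_moment mu) xpredT 0%N n.+1.
move=> /(_ (fun n _ _ => hausdorff_moment_ge0 mu n)); apply: le_trans.
by rewrite big_mkord big_ord_recr /= leeDr// sume_ge0// => i _; exact: hausdorff_moment_ge0.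
Qed.

Lemma moment_ge0 n : 0 <= moment n.
Proof. by rewrite fine_ge0// hausdorff_moment_ge0. Qed.

Lemma moment_cvg : exists S : R, (forall N, \sum_(n < N) moment n <= S) /\
  (fun N => \sum_(n < N) moment n) @ \oo --> S.
Proof.
have [S0 HS0] : exists M, forall N, \sum_(n < N) moment n <= M.
  apply/(nneseries_ltyP moment_ge0).
  by rewrite (eq_eseriesr (g := hausdorff_moment mu))// => n _; exact: momentE.
have nd : nondecreasing_seq (fun N => \sum_(n < N) moment n).
  move=> m n mn; rewrite -(subnKC mn) big_split_ord /= lerDl.
  by apply: sumr_ge0 => i _; exact: moment_ge0.
have cv : cvgn (fun N => \sum_(n < N) moment n).
  by apply: nondecreasing_is_cvgn => //; exists S0 => _ [N _ <-].
exists (limn (fun N => \sum_(n < N) moment n)); split => // N.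
exact: nondecreasing_cvgn_le.
Qed.

Let mX k : measurable_fun (`]0, +oo[%classic : set (measurableTypeR R))
  (fun t => (t ^- k : R)%:E).
Proof. by apply/measurable_EFinP; exact: measurable_invXn. Qed.

Let X0 k (t : R) : `]0, +oo[%classic t -> (0 <= (t ^- k)%:E)%E.
Proof. by move=> /invXn_gt0 H; rewrite lee_fin ltW. Qed.

Lemma invXn_integrable n : mu.-integrable `]0, +oo[ (fun t : R => (t ^- n.+1)%:E).
Proof.
apply/integrableP; split; first exact: mX.
rewrite [X in (X < _)%E](_ : _ = hausdorff_moment mu n); first by rewrite -momentE ltry.
by apply: eq_integral => t; rewrite inE => t0; rewrite gee0_abs// X0.
Qed.

(** Dominated convergence with majorant [K] times the sum of all [t^-(n+1)], whose integral is [K]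
    times the sum of the moments. It is stated for real functions so as to serve real and imaginary
    parts. *)
Lemma moment_series (c : nat -> R) (K : R) (F : R -> R) :
  (forall n, `|c n| <= K) ->
  (forall t, 0 < t -> (fun N => \sum_(n < N) c n * t ^- n.+1) @ \oo --> F t) ->
  mu.-integrable `]0, +oo[ (EFin \o F) /\
  (fun N => \sum_(n < N) c n * moment n) @ \oo --> \int[mu]_(t in `]0, +oo[) F t.
Proof.
move=> cK cF.
have K0 : 0 <= K by exact: le_trans (normr_ge0 _) (cK 0%N).
pose f_ N (t : R) : \bar R := (\sum_(n < N) c n * t ^- n.+1)%:E.
pose g (t : R) : \bar R := (\sum_(0 <= n <oo) (K * t ^- n.+1)%:E)%E.
have Kt0 n (t : R) : `]0, +oo[%classic t -> (0 <= (K * t ^- n.+1)%:E)%E.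
  by move=> /(X0 n.+1); rewrite !lee_fin => H; rewrite mulr_ge0.
have mKt n : measurable_fun (`]0, +oo[%classic : set (measurableTypeR R))
    (fun t => (K * t ^- n.+1 : R)%:E).
  by apply/measurable_EFinP; apply: measurable_funM => //; exact: measurable_invXn.
have mf_ N : measurable_fun (`]0, +oo[%classic : set (measurableTypeR R)) (f_ N).
  apply/measurable_EFinP; apply: measurable_sum => n.
  by apply: measurable_funM => //; exact: measurable_invXn.
have f_F (t : R) : `]0, +oo[%classic t -> f_ ^~ t @ \oo --> (F t)%:E.
  rewrite /= in_itv /= andbT => t0; apply/fine_cvgP; split; first exact: nearW.
  exact: cF.
have mF : measurable_fun (`]0, +oo[%classic : set (measurableTypeR R)) (EFin \o F).
  exact: emeasurable_fun_cvg mf_ f_F.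
have ig : mu.-integrable `]0, +oo[ g.
  apply/integrableP; split.
    have -> : g = fun t => (\sum_(n <oo | n \in xpredT) (K * t ^- n.+1)%:E)%E.
      by apply/funext => t; apply: eq_eseriesl => n.
    apply: (@ge0_emeasurable_sum _ (measurableTypeR R) R `]0, +oo[%classic (fun n t => (K * t ^- n.+1)%:E) xpredT) => //.
    by move=> n t t0 _; exact: Kt0.
  rewrite [X in (X < _)%E](_ : _ = (\int[mu]_(t in `]0%R, +oo[) g t)%E); last first.
    apply: eq_integral => t; rewrite inE => t0; rewrite gee0_abs//.
    by apply: nneseries_ge0 => n _ _; exact: Kt0.
  rewrite /g integral_nneseries//.
  have -> : (\sum_(0 <= n <oo) \int[mu]_(x in `]0%R, +oo[) (K * x ^- n.+1)%:E)%E =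
      (\sum_(0 <= n <oo) (K%:E * hausdorff_moment mu n))%E.
    apply: eq_eseriesr => n _; rewrite /hausdorff_moment -ge0_integralZl//; exact: X0.
  rewrite nneseriesZl//; last by move=> n _; exact: hausdorff_moment_ge0.
  rewrite lte_mul_pinfty// ?lee_fin//.
have fg : {ae mu, forall (t : R) N, `]0, +oo[%classic t -> (`|f_ N t| <= g t)%E}.
  apply: aeW => t N t0; rewrite /f_ abse_EFin.
  apply: (@le_trans _ _ (\sum_(0 <= n < N) (K * t ^- n.+1)%:E)%E); last first.
    by apply: nneseries_lim_ge => n _ _; exact: Kt0.
  rewrite big_mkord sumEFin lee_fin (le_trans (ler_norm_sum _ _ _))//.
  apply: ler_sum => n _; rewrite normrM [X in _ * X]gtr0_norm ?invXn_gt0//.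
  by rewrite ler_wpM2r// ltW// invXn_gt0.
have fF : {ae mu, forall t : R, `]0, +oo[%classic t -> f_ ^~ t @ \oo --> (EFin \o F) t}.
  by apply: aeW => t; exact: f_F.
have [iF _ cv] := dominated_convergence mD mf_ mF fF ig fg.
split=> //.
have fE N : (\int[mu]_(t in `]0%R, +oo[) f_ N t)%E = (\sum_(n < N) c n * moment n)%:E.
  rewrite /f_; under eq_integral do rewrite -sumEFin.
  rewrite integral_sum//; last first.
    move=> n; have := integrableZl mD (c n) (invXn_integrable n).
    by apply: eq_integrable => //.
  rewrite -sumEFin; apply: eq_bigr => n _.
  rewrite EFinM momentE -integralZl//; exact: invXn_integrable.
have {}cv : EFin \o (fun N => \sum_(n < N) c n * moment n) @ \oo -->
    (\int[mu]_(t in `]0, +oo[) F t)%:E.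
  rewrite /Rintegral fineK; last exact: integrable_fin_num.
  by apply: cvg_trans cv; apply: near_eq_cvg; apply: nearW => N /=; rewrite fE.
by have /fine_cvgP[] := cv.
Qed.

End moment_series.

(** * Power series with infinite radius of convergence are entire *)

Section power_series.
Context {R : realType}.
Local Notation C := (R[i]^o).

(** 6 is the sum of the whole series; the closed form with its remainder goes by induction. *)
Let sqr_geom N : \sum_(n < N) n%:R ^+ 2 * 2^-1 ^+ n <= 6 :> R.
Proof.
suff -> : \sum_(n < N) n%:R ^+ 2 * 2^-1 ^+ n =
    6 - 2 * (N%:R ^+ 2 + 2 * N%:R + 3) * 2^-1 ^+ N :> R.
  rewrite gerBl; apply: mulr_ge0; last by rewrite exprn_ge0// invr_ge0.
  by have := sqr_ge0 (N%:R : R); have := ler0n R N; lra.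
elim: N => [|N IH]; first by rewrite big_ord0 expr0; ring.
by rewrite big_ord_recr /= IH [2^-1 ^+ N.+1]exprS -natr1; field.
Qed.

Lemma normc_nat n : normc (n%:R : R[i]) = n%:R.
Proof.
have -> : (n%:R : R[i]) = (n%:R : R)%:C by rewrite rmorph_nat.
by rewrite normc_real normr_nat.
Qed.

(** Induction: the next remainder is [z] times the current one plus [n w^(n-1) (z - w)^2], and
    [n^2 + n <= (n + 1)^2]. Since [rho >= 1], lower powers of [rho] may be raised. *)
Lemma taylor_remainder (z w : R[i]) (rho : R) n : 1 <= rho ->
  normc z <= rho -> normc w <= rho ->
  normc (z ^+ n - w ^+ n - n%:R * w ^+ n.-1 * (z - w)) <=
    n%:R ^+ 2 * rho ^+ n * normc (z - w) ^+ 2.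
Proof.
move=> rho1 zrho wrho; have rho0 : 0 <= rho by exact: le_trans rho1.
set h := normc (z - w).
have h0 : 0 <= h ^+ 2 by exact: sqr_ge0.
elim: n => [|n IH].
  by rewrite !expr0 subrr !mul0r subr0 normc0 mulr1 mulr_ge0 ?sqr_ge0.
have -> : z ^+ n.+1 - w ^+ n.+1 - n.+1%:R * w ^+ n.+1.-1 * (z - w) =
    z * (z ^+ n - w ^+ n - n%:R * w ^+ n.-1 * (z - w)) +
    n%:R * w ^+ n.-1 * (z - w) ^+ 2.
  have -> : n.+1%:R = n%:R + 1 :> R[i] by rewrite natr1.
  (* At [n = 0] the truncated exponent [n.-1] is harmless, as its coefficient is 0. *)
  have wn : n%:R * w ^+ n = n%:R * w ^+ n.-1 * w.
    by case: n {IH} => [|n]; rewrite ?mul0r// -mulrA -exprSr.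
  rewrite /= !(exprS _ n) mulrDl mul1r wn expr2; ring.
apply: le_trans (ler_normcD _ _) _; rewrite !normcM !normcX -/h.
apply: (@le_trans _ _ (rho * (n%:R ^+ 2 * rho ^+ n * h ^+ 2) + n%:R * rho ^+ n.+1 * h ^+ 2)).
  apply: lerD; first by apply: ler_pM => //; exact: normc_ge0.
  rewrite normc_nat ler_wpM2r// ler_wpM2l//.
  apply: (@le_trans _ _ (rho ^+ n.-1)).
    by apply: lerXn2r => //; rewrite nnegrE// normc_ge0.
  by apply: ler_weXn2l => //; exact: leq_trans (leq_pred _) (leqnSn _).
have -> : rho * (n%:R ^+ 2 * rho ^+ n * h ^+ 2) + n%:R * rho ^+ n.+1 * h ^+ 2 =
  (n%:R ^+ 2 + n%:R) * (rho ^+ n.+1 * h ^+ 2) by rewrite (exprS rho); ring.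
apply: (@le_trans _ _ (n.+1%:R ^+ 2 * (rho ^+ n.+1 * h ^+ 2))); last by rewrite mulrA.
apply: ler_wpM2r; first by apply: mulr_ge0 => //; exact: exprn_ge0.
by rewrite -natr1; have := ler0n R n; lra.
Qed.

(** The coefficient bound at radius [2 * rho] leaves a factor [2^-n], which absorbs the [n^2] of the
    remainders; these then sum to at most [6 * M * |z - w|^2]. *)
Lemma power_series_entire (b : nat -> R[i]) (g : C -> C) :
  (forall r : R, 0 < r -> exists M : R, forall n, normc (b n) * r ^+ n <= M) ->
  (forall z, (fun N => \sum_(n < N) b n * z ^+ n : C) @ \oo --> g z) -> entire g.
Proof.
move=> bM bg w; apply/derivablec_lt.
pose rho := normc w + 1.
have rho1 : 1 <= rho by rewrite lerDr normc_ge0.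
have rho0 : 0 < rho by exact: lt_le_trans rho1.
have [M HM] := bM (2 * rho) (mulr_gt0 (ltr0n _ 2) rho0).
have M0 : 0 <= M.
  by apply: le_trans (HM 0%N); rewrite expr0 mulr1 normc_ge0.
have bn n : normc (b n) * rho ^+ n <= M * 2^-1 ^+ n.
  rewrite exprVn ler_pdivlMr ?exprn_gt0// -mulrA [rho ^+ n * _]mulrC -exprMn.
  exact: HM.
have sumM N : \sum_(n < N) M * (n%:R ^+ 2 * 2^-1 ^+ n) <= M * 6.
  by rewrite -mulr_sumr ler_wpM2l// sqr_geom.
have [l Hl] : exists l : C,
    (fun N => \sum_(n < N) b n * (n%:R * w ^+ n.-1) : C) @ \oo --> l.
  apply: (@cseries_cvg R (fun n => b n * (n%:R * w ^+ n.-1)) (M * 6)) => N.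
  apply: le_trans (sumM N); apply: ler_sum => -[n nN] _ /= {nN}.
  rewrite !normcM normcX normc_nat.
  apply: (@le_trans _ _ (n%:R ^+ 2 * (normc (b n) * rho ^+ n))); last first.
    by rewrite [leRHS]mulrCA ler_wpM2l// sqr_ge0.
  rewrite [leRHS]mulrCA ler_wpM2l ?normc_ge0//.
  case: n => [|n]; first by rewrite !mul0r mulr_ge0 ?sqr_ge0.
  apply: ler_pM => //; first by rewrite exprn_ge0// normc_ge0.
    by rewrite expr2 ler_peMl// ler1n.
  apply: (@le_trans _ _ (rho ^+ n)); last by apply: ler_weXn2l.
  apply: lerXn2r; rewrite ?nnegrE ?normc_ge0// ?(ltW rho0)// lerDl//.
exists l => e e0.
pose K := M * 6 + 1.
have K0 : 0 < K by rewrite ltr_wpDl// mulr_ge0.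
exists (Num.min 1 (e / K)); first by rewrite lt_min ltr01 divr_gt0.
move=> z; rewrite lt_min => /andP[zw1 zwe].
have zrho : normc z <= rho.
  by have := ler_normcB z w; rewrite /rho; lra.
have wrho : normc w <= rho by rewrite lerDl.
have cv : (fun N => \sum_(n < N) b n * (z ^+ n - w ^+ n - n%:R * w ^+ n.-1 * (z - w)) : C)
    @ \oo --> (g z - g w - l * (z - w) : C).
  have -> : (fun N => \sum_(n < N) b n * (z ^+ n - w ^+ n - n%:R * w ^+ n.-1 * (z - w)) : C) =
    (fun N => (\sum_(n < N) b n * z ^+ n : C) - (\sum_(n < N) b n * w ^+ n)
       - (\sum_(n < N) b n * (n%:R * w ^+ n.-1)) * (z - w)).
    apply/funext => N; rewrite mulr_suml -!sumrB; apply: eq_bigr => n _.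
    by ring.
  apply: cvgB; first by apply: cvgB; exact: bg.
  by apply: cvgM; [exact: Hl|exact: cvg_cst].
have H : normc (g z - g w - l * (z - w)) <= M * 6 * normc (z - w) ^+ 2.
  apply: cvgc_le cv _; apply: nearW => N.
  apply: le_trans (normc_sum _ _ _) _.
  apply: (@le_trans _ _ (\sum_(n < N) M * (n%:R ^+ 2 * 2^-1 ^+ n) * normc (z - w) ^+ 2)).
    apply: ler_sum => n _; rewrite normcM.
    apply: le_trans (ler_wpM2l (normc_ge0 _) (taylor_remainder n rho1 zrho wrho)) _.
    set h := normc (z - w).
    have -> : normc (b n) * (n%:R ^+ 2 * rho ^+ n * h ^+ 2) =
        n%:R ^+ 2 * (normc (b n) * rho ^+ n) * h ^+ 2 by ring.
    have -> : M * (n%:R ^+ 2 * 2^-1 ^+ n) * h ^+ 2 =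
        n%:R ^+ 2 * (M * 2^-1 ^+ n) * h ^+ 2 by ring.
    by rewrite ler_wpM2r ?sqr_ge0// ler_wpM2l ?sqr_ge0.
  by rewrite -mulr_suml ler_wpM2r ?sqr_ge0.
rewrite (le_trans H)// expr2 mulrA ler_wpM2r ?normc_ge0//.
apply: (@le_trans _ _ (K * normc (z - w))).
  by rewrite ler_wpM2r ?normc_ge0// lerDl.
by rewrite -ler_pdivlMl// mulrC ltW.
Qed.

End power_series.

(** * The Hausdorff operator as a series of rank one operators *)

Section nuclear_hausdorff.
Context {R : realType} (alpha : R) (mu : {measure set (measurableTypeR R) -> \bar R}).
Hypothesis alpha0 : 0 < alpha.
Hypothesis mu_sum : (\sum_(0 <= n <oo) hausdorff_moment mu n < +oo)%E.
Local Notation C := (R[i]^o).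
Local Notation Re := complex.Re.
Local Notation Im := complex.Im.
Local Notation m := (moment mu).
Implicit Types f : fock_infty alpha.

(* The Cauchy estimates give the constant [2]; the other factor only serves [z = 0],
   where the estimate on the unit circle is used. *)
Let K : R := 2 * expR (alpha / 2).

Let K_ge2 : 2 <= K.
Proof. by rewrite ler_peMr// -expR0 ler_expR divr_ge0// ltW. Qed.

Let K_ge0 : 0 <= K. Proof. exact: le_trans K_ge2. Qed.

Lemma fock_entire f : entire f. Proof. by have [] := fock_inftyP f. Qed.

(** Cauchy's estimate on the circle through [z], where the Gaussian is constant and so can be
    absorbed into the norm of [f]. *)
Lemma coef_weight_le f n (z : C) :
  normc (coef f n) * normc z ^+ n * gauss alpha z <= K * rnorm f.
Proof.
have g0 u : 0 < gauss alpha u by exact: gauss_gt0.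
have key (r : R) (u : C) : 0 < r -> normc u = r ->
    normc (coef f n) * r ^+ n * gauss alpha u <= 2 * rnorm f.
  move=> r0 ur; rewrite -ler_pdivlMr// -mulrA; apply: coef_le => //.
    exact: fock_entire.
  move=> v vr; rewrite ler_pdivlMr//.
  have -> : gauss alpha u = gauss alpha v by rewrite /gauss !rnorm_normc ur vr.
  exact: fock_weight_le_norm.
have f0 : 0 <= rnorm f by exact: rnorm_ge0.
have [->|z0] := eqVneq z 0; last first.
  rewrite (le_trans (key (normc z) z _ erefl)) ?normc_gt0//.
  by rewrite ler_wpM2r.
have -> : gauss alpha 0 = 1 by rewrite /gauss rnorm0 expr0n mulr0 expR0.
rewrite normc0 mulr1; case: n key => [|n] key; last first.
  by rewrite expr0n mulr0 mulr_ge0//.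
have := key 1 1 ltr01 (@normc1 R).
rewrite expr1n expr0 !mulr1 /gauss rnorm_normc normc1 expr1n mulr1 expRN.
by rewrite ler_pdivrMr ?expR_gt0// /K mulrAC.
Qed.

(** A bound for the Taylor terms at [z] that is uniform in [n], as [moment_series] requires. *)
Let W f (z : C) : R := K * rnorm f / gauss alpha z.

Let W_ge0 f z : 0 <= W f z.
Proof.
rewrite divr_ge0 ?(ltW (gauss_gt0 _ _))// mulr_ge0 ?rnorm_ge0//.
Qed.

Let coef_le_W f n (z : C) : normc (coef f n * z ^+ n) <= W f z.
Proof. by rewrite normcM normcX ler_pdivlMr ?gauss_gt0// coef_weight_le. Qed.

(** For fixed [z] the integrand is the sum of [a_n z^n t^-(n+1)]; [moment_series] integrates its
    real and imaginary parts term by term. *)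
Lemma hausdorff_series f (z : C) : hausdorff_integrable mu f z /\
  (fun N => \sum_(n < N) (m n)%:C * (coef f n * z ^+ n) : C) @ \oo --> hausdorff mu f z.
Proof.
pose c n := coef f n * z ^+ n.
have cv (t : R) : 0 < t ->
    (fun N => \sum_(n < N) c n * (t ^- n.+1)%:C : C) @ \oo --> hausdorff_integrand f z t.
  move=> t0.
  have -> : (fun N => \sum_(n < N) c n * (t ^- n.+1)%:C : C) =
      (fun N => (\sum_(n < N) coef f n * (z / t%:C) ^+ n : C) * (t%:C)^-1).
    apply/funext => N; rewrite mulr_suml; apply: eq_bigr => n _.
    rewrite /c -exprVn rmorphXn fmorphV exprS exprMn; ring.
  by apply: cvgM; [apply: taylor; exact: fock_entire|exact: cvg_cst].
have part (p : R[i] -> R) : (forall w, `|p w| <= normc w) ->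
    (forall w (x : R), p (w * x%:C) = p w * x) ->
    (forall (I : nat) (F : nat -> R[i]), p (\sum_(n < I) F n) = \sum_(n < I) p (F n)) ->
    (forall (u : nat -> C) (l : C), u @ \oo --> l -> (fun N => p (u N)) @ \oo --> p l) ->
    mu.-integrable `]0, +oo[ (fun t => (p (hausdorff_integrand f z t))%:E) /\
    (fun N => p (\sum_(n < N) (m n)%:C * c n)) @ \oo -->
      \int[mu]_(t in `]0, +oo[) p (hausdorff_integrand f z t).
  move=> pn pZ pS pc.
  have [] := @moment_series R mu mu_sum (fun n => p (c n)) (W f z)
      (fun t => p (hausdorff_integrand f z t)).
  - by move=> n; exact: le_trans (pn _) (coef_le_W f n z).
  - move=> t /cv /pc; apply: cvg_trans; apply: near_eq_cvg; apply: nearW => N.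
    by rewrite /= (pS N (fun n => c n * (t ^- n.+1)%:C)); apply: eq_bigr => n _; rewrite pZ.
  - move=> ip cp; split=> //; apply: cvg_trans cp; apply: near_eq_cvg; apply: nearW => N.
    by rewrite /= (pS N (fun n => (m n)%:C * c n)); apply: eq_bigr => n _; rewrite [(m n)%:C * _]mulrC pZ.
have [ir cr] : mu.-integrable `]0, +oo[ (fun t => (Re (hausdorff_integrand f z t))%:E) /\
    (fun N => Re (\sum_(n < N) (m n)%:C * c n)) @ \oo -->
      \int[mu]_(t in `]0, +oo[) Re (hausdorff_integrand f z t).
  apply: part => [w|w x|I F|u l].
  - exact: normc_Re.
  - by rewrite ReM /= mulr0 subr0.
  - by elim/big_ind2 : _ => // ? ? ? ? <- <-; exact: ReD.
  - by move=> /cvg_ReIm[].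
have [ii ci] : mu.-integrable `]0, +oo[ (fun t => (Im (hausdorff_integrand f z t))%:E) /\
    (fun N => Im (\sum_(n < N) (m n)%:C * c n)) @ \oo -->
      \int[mu]_(t in `]0, +oo[) Im (hausdorff_integrand f z t).
  apply: part => [w|w x|I F|u l].
  - exact: normc_Im.
  - by rewrite ImM /= mulr0 add0r.
  - by elim/big_ind2 : _ => // ? ? ? ? <- <-; exact: ImD.
  - by move=> /cvg_ReIm[].
by split; [split|apply/cvg_ReIm; split].
Qed.

Lemma hausdorff_cvg f (z : C) :
  (fun N => \sum_(n < N) (m n)%:C * (coef f n * z ^+ n) : C) @ \oo --> hausdorff mu f z.
Proof. by have [] := hausdorff_series f z. Qed.

Variable S : R.
Hypothesis S_ge : forall N, \sum_(n < N) m n <= S.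
Hypothesis S_cvg : (fun N => \sum_(n < N) m n) @ \oo --> S.

Let normc_m n : normc (m n)%:C = m n.
Proof. by rewrite normc_real ger0_norm// moment_ge0. Qed.

(** Uniformity in [z] lets this one estimate serve both the decay at infinity and the convergence in
    operator norm. *)
Lemma hausdorff_tail f (z : C) N :
  normc (hausdorff mu f z - \sum_(n < N) (m n)%:C * (coef f n * z ^+ n)) * gauss alpha z <=
    K * rnorm f * (S - \sum_(n < N) m n).
Proof.
rewrite -ler_pdivlMr ?gauss_gt0// mulrAC -/(W f z).
have cv : (fun M => \sum_(n < M) (m n)%:C * (coef f n * z ^+ n)
      - \sum_(n < N) (m n)%:C * (coef f n * z ^+ n) : C) @ \oo -->
    (hausdorff mu f z - \sum_(n < N) (m n)%:C * (coef f n * z ^+ n) : C).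
  by apply: cvgB; [exact: hausdorff_cvg|exact: cvg_cst].
apply: cvgc_le cv _; exists N => // M /= NM.
rewrite -(subnKC NM) big_split_ord /= addrAC subrr add0r.
apply: le_trans (normc_sum _ _ _) _.
apply: (@le_trans _ _ (\sum_(i < M - N) W f z * m (N + i))).
  by apply: ler_sum => i _; rewrite normcM normc_m mulrC ler_wpM2r ?moment_ge0.
rewrite -mulr_sumr ler_wpM2l// lerBrDl.
by have := S_ge (N + (M - N)); rewrite big_split_ord.
Qed.

Lemma moment_le n : m n <= S.
Proof.
apply: le_trans (S_ge n.+1); rewrite big_ord_recr /= lerDr.
by apply: sumr_ge0 => i _; exact: moment_ge0.
Qed.

Lemma hausdorff_entire f : entire (hausdorff mu f).
Proof.
apply: (@power_series_entire _ (fun n => (m n)%:C * coef f n)).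
  move=> r r0; exists (S * W f r%:C) => n.
  have rn : normc (r%:C : R[i]) = r by rewrite normc_real gtr0_norm.
  rewrite normcM normc_m -mulrA; apply: ler_pM; rewrite ?moment_ge0 ?moment_le//.
    by rewrite mulr_ge0 ?normc_ge0// exprn_ge0// ltW.
  by have := coef_le_W f n r%:C; rewrite normcM normcX rn.
move=> z; have -> : (fun N => \sum_(n < N) (m n)%:C * coef f n * z ^+ n : C) =
    (fun N => \sum_(n < N) (m n)%:C * (coef f n * z ^+ n)).
  by apply/funext => N; apply: eq_bigr => n _; rewrite mulrA.
exact: hausdorff_cvg.
Qed.

Let poly f N : fock_infty alpha :=
  \sum_(n < N) monomial alpha0 ((m n)%:C * coef f n) n.

Let polyE f N (z : C) : poly f N z = \sum_(n < N) (m n)%:C * (coef f n * z ^+ n).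
Proof. by rewrite fock_sumE; apply: eq_bigr => n _; rewrite /= mulrA. Qed.

(** The image is a limit in the weighted supremum norm of polynomials, and each of these has
    weighted modulus tending to 0 at infinity. *)
Lemma hausdorff_fock f : is_fock_infty alpha (hausdorff mu f).
Proof.
split; first exact: hausdorff_entire.
apply/cvgrPdist_lt => e e0.
have KW0 : 0 < K * rnorm f + 1.
  by rewrite ltr_wpDl// mulr_ge0 ?rnorm_ge0//.
have e1 : 0 < e / 2 / (K * rnorm f + 1) by rewrite !divr_gt0.
have [N _ HN] := (cvgrPdist_lt _ _).1 S_cvg _ e1.
have {}HN := HN N (leqnn N).
have [_ /cvgrPdist_lt/(_ (e / 2) (divr_gt0 e0 (ltr0n _ 2)))] := fock_inftyP (poly f N).
apply: filterS => z; rewrite !sub0r !normrN !ger0_norm ?fock_weight_ge0// => Hz.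
rewrite (splitr e); apply: le_lt_trans (ltrD Hz (_ : K * rnorm f * (S - \sum_(n < N) m n) < e / 2)).
  apply: le_trans (lerD (lexx _) (hausdorff_tail f z N)).
  rewrite /fock_weight -mulrDl ler_wpM2r ?(ltW (gauss_gt0 _ _))// polyE.
  rewrite !rnorm_normc; set a := \sum_(n < N) _.
  by rewrite -{1}(subrK a (hausdorff mu f z)) addrC ler_normcD.
have S0 : 0 <= S - \sum_(n < N) m n by rewrite subr_ge0.
rewrite (@le_lt_trans _ _ ((K * rnorm f + 1) * (S - \sum_(n < N) m n)))//.
  by rewrite ler_wpM2r// lerDl.
by rewrite mulrC -ltr_pdivlMr//; move: HN; rewrite ger0_norm.
Qed.

Definition hausdorff_fun f : fock_infty alpha :=
  FockInfty (introT (fock_infty_predP _ _) (hausdorff_fock f)).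

(** Read off the series, whose coefficients are linear in [f], by uniqueness of limits. *)
Lemma hausdorff_fun_linear : linear hausdorff_fun.
Proof.
move=> a f g; apply/val_inj/funext => z.
change (hausdorff mu (a *: f + g) z = a * hausdorff mu f z + hausdorff mu g z).
have H := @hausdorff_cvg (a *: f + g) z.
apply: (@cvgc_unique _ _ _ _ H) => {H}.
have -> : (fun N => \sum_(n < N) (m n)%:C * (coef (a *: f + g) n * z ^+ n) : C) =
    (fun N => a * (\sum_(n < N) (m n)%:C * (coef f n * z ^+ n)) +
              \sum_(n < N) (m n)%:C * (coef g n * z ^+ n) : C).
  apply/funext => N; rewrite mulr_sumr -big_split; apply: eq_bigr => n _ /=.
  have af : entire (fun z => a * f z) by exact: (@fock_entire (a *: f)).
  by rewrite (coefD n af (@fock_entire g)) (coefZ a n (@fock_entire f)); ring.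
apply: cvgD; last exact: hausdorff_cvg.
by apply: cvgM; [exact: cvg_cst|exact: hausdorff_cvg].
Qed.

HB.instance Definition _ := GRing.isLinear.Build _ _ _ _ hausdorff_fun hausdorff_fun_linear.

Let N_ n : R := rnorm (monomial alpha0 1 n).

Let N_gt0 n : 0 < N_ n.
Proof.
apply: lt_le_trans (fock_weight_le_norm _ 1); rewrite mulr_gt0 ?gauss_gt0//.
by rewrite /= rnorm_normc mul1r expr1n normc1.
Qed.

(** The norm of [z^n] sits in the functional, so the vectors can be normalized while the functional
    has norm at most [K] times the moment. *)
Definition coef_functional n f : C := (m n * N_ n)%:C * coef f n.

Lemma coef_functional_linear n : linear (coef_functional n : fock_infty alpha -> C).
Proof.
move=> a f g; rewrite /coef_functional.
have af : entire (fun z => a * f z) by exact: (@fock_entire (a *: f)).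
rewrite (coefD n af (@fock_entire g)) (coefZ a n (@fock_entire f)) mulrDr.
by congr (_ + _); rewrite mulrCA.
Qed.

HB.instance Definition _ n :=
  GRing.isLinear.Build _ _ _ _ (coef_functional n) (coef_functional_linear n).

Lemma coef_functional_le n f : rnorm (coef_functional n f) <= m n * K * rnorm f.
Proof.
rewrite rnorm_normc normcM normc_real ger0_norm ?mulr_ge0 ?moment_ge0 ?(ltW (N_gt0 _))//.
rewrite -[leLHS]mulrA -[leRHS]mulrA ler_wpM2l ?moment_ge0//.
have [c0|c0] := eqVneq (normc (coef f n)) 0.
  by rewrite c0 mulr0 mulr_ge0 ?rnorm_ge0.
have cp : 0 < normc (coef f n) by rewrite lt_def c0 normc_ge0.
rewrite -ler_pdivlMr// /N_ rnorm_fock; apply: fock_norm_le => z.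
rewrite ler_pdivlMr// /fock_weight /= rnorm_normc mul1r normcX.
apply: le_trans (coef_weight_le f n z); rewrite le_eqVlt; apply/orP; left.
by apply/eqP; ring.
Qed.

Lemma hausdorff_nuclear : is_hausdorff_operator mu hausdorff_fun /\ nuclear hausdorff_fun.
Proof.
have tail N f : rnorm (hausdorff_fun f -
    \sum_(n < N) coef_functional n f *: ((N_ n)^-1%:C *: monomial alpha0 1 n)) <=
    K * (S - \sum_(n < N) m n) * rnorm f.
  rewrite rnorm_fock mulrAC; apply: fock_norm_le => z.
  set P := \sum_(n < N) _.
  change (normc (hausdorff mu f z - P z) * gauss alpha z <=
    K * rnorm f * (S - \sum_(n < N) m n)).
  have -> : P z = \sum_(n < N) (m n)%:C * (coef f n * z ^+ n).
    rewrite /P fock_sumE; apply: eq_bigr => n _.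
    have Nn : (N_ n)%:C != 0 :> R[i] by rewrite -normc_gt0 normc_real normr_gt0 gt_eqF.
    have E1 : (m n * N_ n)%:C = (m n)%:C * (N_ n)%:C :> R[i] by rewrite rmorphM.
    have E2 : (N_ n)^-1%:C = ((N_ n)%:C)^-1 :> R[i] by rewrite fmorphV.
    rewrite !fock_scaleE /coef_functional E1 E2 /= mul1r.
    by move: ((N_ n)%:C) Nn => v v0; field.
  exact: hausdorff_tail.
split; last first.
  exists (fun n => coef_functional n), (fun n => (N_ n)^-1%:C *: monomial alpha0 1 n); split.
  - apply: (@le_lt_trans _ _ (\sum_(0 <= n <oo) (m n * K)%:E)%E).
      apply: lee_nneseries => n _; first by move=> _; exact: opnorm_ge0.
      apply: opnorm_le; first by rewrite mulr_ge0 ?moment_ge0.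
      exact: coef_functional_le.
    apply/nneseries_ltyP; first by move=> n; rewrite mulr_ge0 ?moment_ge0.
    by exists (S * K) => N; rewrite -mulr_suml ler_wpM2r.
  - exists 1 => n; rewrite rnorm_scale ger0_norm ?invr_ge0 ?(ltW (N_gt0 _))//.
    by rewrite mulVf// gt_eqF.
  - apply: (@squeeze_cvge _ _ _ _ (cst 0%E) _ (fun N => (K * (S - \sum_(n < N) m n))%:E)).
    + apply: nearW => N; rewrite opnorm_ge0 /=; apply: opnorm_le; last exact: tail.
      by apply: mulr_ge0; [exact: K_ge0|rewrite subr_ge0; exact: S_ge].
    + exact: cvg_cst.
    + apply/fine_cvgP; split; first exact: nearW.
      rewrite -[X in _ --> X](mulr0 K); apply: cvgM; first exact: cvg_cst.
      by rewrite -[X in _ --> X](subrr S); apply: cvgB; [exact: cvg_cst|exact: S_cvg].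
split.
  by move=> f z; have [] := hausdorff_series f z.
apply: (@le_lt_trans _ _ (K * S)%:E); last exact: ltry.
apply: opnorm_le; first by rewrite mulr_ge0// (le_trans (moment_ge0 mu 0)) ?moment_le.
(* With no terms subtracted, the tail estimate is the boundedness of the operator. *)
by move=> f; have := tail 0%N f; rewrite !big_ord0 !subr0.
Qed.

End nuclear_hausdorff.

Theorem theorem9p2 (R : realType) (alpha : R) (halpha : 0 < alpha)
    (mu : {measure set (measurableTypeR R) -> \bar R}) :
  let stmt_i :=
    (\sum_(0 <= n <oo) hausdorff_moment mu n < +oo)%E in
  let stmt_ii :=
    exists T : {linear fock_infty alpha -> fock_infty alpha},
      is_hausdorff_operator mu T /\ nuclear T in
  let stmt_iii :=
    exists T : {linear fock_infty alpha -> fock_infty alpha},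
      is_hausdorff_operator mu T /\ absolutely_summing T in
  let stmt_iv :=
    (\sum_(0 <= n <oo) hausdorff_moment mu n * ((Num.sqrt n.+1%:R)^-1)%R%:E
       < +oo)%E in
  [/\ stmt_i -> stmt_ii, stmt_ii -> stmt_iii & stmt_iii -> stmt_iv].
Proof.
move=> i ii iii iv; split.
- move=> mu_sum; have [S [S_ge S_cvg]] := moment_cvg mu_sum.
  by exists (hausdorff_fun halpha mu_sum S_ge S_cvg); exact: hausdorff_nuclear.
- move=> [T [hT nT]]; exists T; split=> //.
  by apply: nuclear_absolutely_summing nT; have [] := hT.
- by move=> [T [hT /(absolutely_summing_moments halpha hT)]].
Qed.
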